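(* Let $G$ be a connected graph of order $n$, where $n\ge 270$. Suppose that $NC(G)\ge \frac{n-1}{2}$. Then $G$ has a HIST if and only if $G$ is not isomorphic to any graph of type $H_1$, $H_2$ or $H_3$ of order $n$, and $G$ is not a graph with a pendant vertex which is adjacent to a vertex of degree $2$.
   Context: All graphs are finite and simple. The order of a graph is its number of vertices. $N(v)$ is the set of neighbors of $v$ and $d(v)=|N(v)|$. A pendant vertex is a vertex of degree $1$. For a connected graph $G$, $NC(G):=\min\{|N(u)\cup N(v)| : uv\notin E(G),\ u\ne v\}$; a lower bound $NC(G)\ge c$ means that $|N(u)\cup N(v)|\ge c$ for every pair of distinct nonadjacent vertices $u,v$ (so it holds vacuously for complete graphs). A homeomorphically irreducible spanning tree (HIST) of a connected graph $G$ is a spanning tree of $G$ with no vertex of degree $2$ (degree taken in the tree). The graphs of type $H_1,H_2,H_3$ are defined for odd $n\ge 5$ as follows. - $H_1$: a connected graph of order $n$ containing a cut-vertex $v$ of degree $2$ such that $H_1-v$ has exactly two components, each isomorphic to $K_{(n-1)/2}$. - $H_2$: let $G_0,G_1,G_2$ be vertex-disjoint graphs, where $G_0\cong K_3$ has vertex set $\{v_1,v_2,v_3\}$ and $G_1\cong G_2\cong K_{(n-3)/2}$. $H_2$ is obtained from $G_0,G_1,G_2$ by adding, for each $i\in\{1,2\}$, an edge joining $v_i$ to a vertex $u_i$ of $G_i$. - $H_3$: obtained from $H_2$ by adding an edge joining $v_3$ to a vertex $u_3$ of $G_2$ (possibly $u_3=u_2$). *)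

(* Defs.v *)
From HB Require Import structures.
From mathcomp Require Import all_boot all_order all_algebra.

Set Implicit Arguments.
Unset Strict Implicit.
Unset Printing Implicit Defensive.

Record sgraph (V : finType) := SGraph {
  edge :> rel V;
  edge_sym : symmetric edge;
  edge_irrefl : irreflexive edge }.

Section Basic.
Variables (V : finType) (G : sgraph V).

Definition neighbors (v : V) : {set V} := [set w | G v w].

Definition degree (v : V) : nat := #|neighbors v|.

Definition connected : Prop := forall x y : V, connect G x y.

Definition components : {set {set V}} :=
  equivalence_partition (connect G) [set: V].

(* Cycles of length at most 2 are excluded: an edge x y makes [:: x; y] a
   ucycle. *)
Definition acyclic : Prop :=
  forall c : seq V, 2 < size c -> ~~ ucycleb G c.

Definition is_tree : Prop := connected /\ acyclic.

(* NC(G) >= c, with NC(G) = +oo when G is complete. *)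
Definition NC_ge (c : rat) : Prop :=
  forall u v : V, u != v -> ~~ G u v ->
    (c <= #|neighbors u :|: neighbors v|%:R)%R.

End Basic.

Definition spanning_tree (V : finType) (G T : sgraph V) : Prop :=
  subrel T G /\ is_tree T.

Definition has_HIST (V : finType) (G : sgraph V) : Prop :=
  exists2 T : sgraph V, spanning_tree G T & forall v : V, degree T v != 2.

Definition isomorphic (V W : finType) (G : sgraph V) (H : sgraph W) : Prop :=
  exists2 f : V -> W, bijective f & forall x y : V, H (f x) (f y) = G x y.

Section Induced.
Variables (V : finType) (G : sgraph V) (A : {set V}).

Definition induced_rel : rel {x : V | x \in A} :=
  fun x y => G (val x) (val y).

Lemma induced_sym : symmetric induced_rel.
Proof. by move=> x y; rewrite /induced_rel edge_sym. Qed.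

Lemma induced_irrefl : irreflexive induced_rel.
Proof. by move=> x; rewrite /induced_rel edge_irrefl. Qed.

Definition induced : sgraph {x : V | x \in A} :=
  SGraph induced_sym induced_irrefl.

End Induced.

Definition delete_vertex (V : finType) (G : sgraph V) (v : V) :=
  induced G [set~ v].

Definition cut_vertex (V : finType) (G : sgraph V) (v : V) : Prop :=
  #|components G| < #|components (delete_vertex G v)|.

Section Complete.
Variable m : nat.

Definition complete_rel : rel 'I_m := fun x y => x != y.

Lemma complete_sym : symmetric complete_rel.
Proof. by move=> x y; rewrite /complete_rel eq_sym. Qed.

Lemma complete_irrefl : irreflexive complete_rel.
Proof. by move=> x; rewrite /complete_rel eqxx. Qed.

Definition complete : sgraph 'I_m := SGraph complete_sym complete_irrefl.

End Complete.

Section DisjointUnion.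
Variables (V W : finType) (G : sgraph V) (H : sgraph W).

Definition disjoint_union_rel : rel (V + W)%type := fun x y =>
  match x, y with
  | inl a, inl b => G a b
  | inr a, inr b => H a b
  | _, _ => false
  end.

Lemma disjoint_union_sym : symmetric disjoint_union_rel.
Proof. by case=> a [] b //=; rewrite edge_sym. Qed.

Lemma disjoint_union_irrefl : irreflexive disjoint_union_rel.
Proof. by case=> a /=; rewrite edge_irrefl. Qed.

Definition disjoint_union : sgraph (V + W)%type :=
  SGraph disjoint_union_sym disjoint_union_irrefl.

End DisjointUnion.

Section AddEdge.
Variables (V : finType) (G : sgraph V) (x y : V).

(* Nothing is added when x = y. *)
Definition add_edge_rel : rel V := fun a b =>
  G a b ||
  (a != b) && ((a == x) && (b == y) || (a == y) && (b == x)).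

Lemma add_edge_sym : symmetric add_edge_rel.
Proof.
move=> a b; rewrite /add_edge_rel edge_sym (eq_sym b a); congr (_ || _ && _).
by rewrite orbC andbC [(a == x) && _]andbC.
Qed.

Lemma add_edge_irrefl : irreflexive add_edge_rel.
Proof. by move=> a; rewrite /add_edge_rel edge_irrefl eqxx. Qed.

Definition add_edge : sgraph V := SGraph add_edge_sym add_edge_irrefl.

End AddEdge.

Definition type_H1 (n : nat) (V : finType) (H : sgraph V) : Prop :=
  [/\ odd n, 5 <= n, #|V| = n, connected H &
      exists v : V,
        [/\ cut_vertex H v, degree H v = 2,
            #|components (delete_vertex H v)| = 2 &
            forall C, C \in components (delete_vertex H v) ->
              isomorphic (induced (delete_vertex H v) C)
                         (complete (n.-1)./2)]].

Section H2H3.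
Variable m : nat.

Definition H_vertex : finType := ('I_3 + ('I_m + 'I_m))%type.

Definition inG0 (i : 'I_3) : H_vertex := inl i.
Definition inG1 (u : 'I_m) : H_vertex := inr (inl u).
Definition inG2 (u : 'I_m) : H_vertex := inr (inr u).

Definition v1 : 'I_3 := @Ordinal 3 0 isT.
Definition v2 : 'I_3 := @Ordinal 3 1 isT.
Definition v3 : 'I_3 := @Ordinal 3 2 isT.

Definition H2_graph (u1 u2 : 'I_m) : sgraph H_vertex :=
  add_edge
    (add_edge
       (disjoint_union (complete 3)
                       (disjoint_union (complete m) (complete m)))
       (inG0 v1) (inG1 u1))
    (inG0 v2) (inG2 u2).

Definition H3_graph (u1 u2 u3 : 'I_m) : sgraph H_vertex :=
  add_edge (H2_graph u1 u2) (inG0 v3) (inG2 u3).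

End H2H3.

Definition type_H2 (n : nat) (V : finType) (H : sgraph V) : Prop :=
  [/\ odd n, 5 <= n &
      exists u1 u2 : 'I_((n - 3)./2), isomorphic H (H2_graph u1 u2)].

Definition type_H3 (n : nat) (V : finType) (H : sgraph V) : Prop :=
  [/\ odd n, 5 <= n &
      exists u1 u2 u3 : 'I_((n - 3)./2), isomorphic H (H3_graph u1 u2 u3)].

Definition pendant_adjacent_to_degree_2 (V : finType) (G : sgraph V) : Prop :=
  exists x y : V, [/\ degree G x = 1, degree G y = 2 & G x y].

(* Main.v *)
Require Import Defs.
From HB Require Import structures.
From mathcomp Require Import all_boot all_order all_algebra.
From mathcomp Require Import zify.

(* Call a vertex low if its degree is less than (n-1)/4; by the hypothesis on
   neighbourhood unions the low vertices form a clique L.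

   A tree without vertices of degree 2 can be grown from its inner vertices
   alone: if S carries such a tree with inner vertices I, any vertex l of S or
   adjacent to I can be made inner as soon as it has two neighbours outside S,
   and a HIST exists once S and the neighbours of I exhaust the graph.  Since
   |S| <= 3|I| + 1, every high vertex can be promoted while |I| is at most
   about n/12.  Let R be the set of high vertices not yet reached.  While R is
   large, either a promotion of one, two or three consecutive vertices removes a
   definite proportion of R, or counting the edges between R and the reached
   vertices gives a contradiction; this brings |R| below 52n/1000 with
   |I| <= 18.  The remaining vertices x are absorbed one at a time: otherwise the
   reached high neighbours of x would form a clique inside S \ I (two
   nonadjacent ones would violate the hypothesis), which is too small.

   The growth gets stuck only if a component of G - L is never entered.  If
   G - L is connected, it is started at a star centered at a low vertex, or next
   to one.  Otherwise G - L has exactly two components, and the growth is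
   started at a star or a double star with centers in L meeting both; when no
   such start exists, counting forces G to be of type H1, H2 or H3. *)

Set Implicit Arguments.
Unset Strict Implicit.
Unset Printing Implicit Defensive.

(** * Growing trees without vertices of degree two *)

Section Trees.
Variables (V : finType) (G : sgraph V).

(* [hit S I]: some subtree of G without vertices of degree 2 has vertex set S
   and set of inner vertices I (HIT = homeomorphically irreducible tree). *)
Inductive hit : {set V} -> {set V} -> Prop :=
| hit_star c x y z : uniq [:: x; y; z] -> G c x -> G c y -> G c z ->
    hit [set c; x; y; z] [set c]
| hit_attach S I u x : hit S I -> u \in I -> x \notin S -> G u x ->
    hit (x |: S) I
| hit_grow S I u x y : hit S I -> u \in S -> u \notin I ->
    x \notin S -> y \notin S -> x != y -> G u x -> G u y ->
    hit (x |: (y |: S)) (u |: I).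

(** The tree is encoded by a parent function with a height that increases away from the root [c],
    which rules out cycles. An inner vertex has its parent and at least two children, the root at
    least three children, and all parents lie in [I]; hence no degree is 2. *)
Definition rooted (S I : {set V}) (c : V) (par : V -> V) (h : V -> nat) :=
  [/\ c \in I, I \subset S,
      forall x, x \in S -> x != c ->
        [/\ par x \in I, G (par x) x & h (par x) < h x] &
      forall u, u \in I ->
        2 + (u == c) <= #|[set x in S | (x != c) && (par x == u)]|].

Lemma edge_neq x y : G x y -> x != y.
Proof. by apply: contraTneq => ->; rewrite edge_irrefl. Qed.

Lemma hit_rooted S I : hit S I -> exists c par h, rooted S I c par h.
Proof.
elim=> {S I} [c x y z Uxyz cx cy cz|S I u x _ [c [par [h [cI sIS parP chP]]]] uI xS ux|
  S I u x y _ [c [par [h [cI sIS parP chP]]]] uS uI xS yS xy ux uy].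
- exists c, (fun=> c), (fun v => v != c : nat); split.
  + by rewrite inE.
  + by apply/subsetP=> v; rewrite !inE => ->.
  + move=> v; rewrite !inE => vS vc; split; rewrite ?inE ?eqxx ?vc //.
    by move: vS; rewrite (negPf vc) /= => /orP[/orP[]|] /eqP->.
  + move=> v; rewrite inE => /eqP->; rewrite eqxx.
    have -> : 2 + true = #|[set x; y; z]|.
      move: Uxyz; rewrite /= !inE negb_or => /and3P[/andP[xy xz] yz _].
      by rewrite -setUA cardsU1 cards2 !inE negb_or xy xz yz.
    apply/subset_leq_card/subsetP=> t; rewrite !inE ?eqxx ?andbT.
    by case/orP=> [/orP[]|] /eqP->; rewrite eqxx ?orbT /= eq_sym edge_neq.
- have xNc : x != c by apply: contraNneq xS => ->; exact: subsetP sIS _ cI.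
  have xNI v : v \in I -> v != x by move=> vI; apply: contraNneq xS => <-; exact: subsetP sIS _ vI.
  (* The old data is changed only at [x], which is no parent of an old vertex because parents lie in
     [I], inside [S]. *)
  exists c, (fun v => if v == x then u else par v),
    (fun v => if v == x then (h u).+1 else h v); split=> //.
  + by apply: subset_trans sIS _; exact: subsetUr.
  + move=> v; rewrite !inE; have [->|vx] /= := eqVneq v x.
      by rewrite (negPf (xNI _ uI)).
    move=> vS vc; have [pI pG ph] := parP _ vS vc.
    by rewrite (negPf (xNI _ pI)).
  + move=> v vI; apply: leq_trans (chP v vI) _.
    apply/subset_leq_card/subsetP=> t; rewrite !inE => /and3P[tS tc /eqP <-].
    have tx : t != x by apply: contraNneq xS => <-.
    by rewrite tS tc orbT (negPf tx) /=.
- have cS : c \in S by exact: subsetP sIS _ cI.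
  have Nx v : v \in S -> v != x by move=> vI; apply: contraNneq xS => <-.
  have Ny v : v \in S -> v != y by move=> vI; apply: contraNneq yS => <-.
  have IS := subsetP sIS.
  have uc : u != c by apply: contraNneq uI => ->.
  exists c, (fun v => if (v == x) || (v == y) then u else par v),
    (fun v => if (v == x) || (v == y) then (h u).+1 else h v); split=> //.
  + by rewrite inE cI orbT.
  + apply/subsetP=> v; rewrite !inE => /orP[/eqP->|/IS->]; rewrite ?uS ?orbT //.
  + move=> v; rewrite !inE orbA; have [vxy|] /= := boolP ((v == x) || (v == y)).
      rewrite eqxx (negPf (Nx _ uS)) (negPf (Ny _ uS)) /= => _ vc; split=> //.
      by case/orP: vxy => /eqP->.
    move=> vxy vS vc; have [pI pG ph] := parP _ vS vc.
    by rewrite pI orbT (negPf (Nx _ (IS _ pI))) (negPf (Ny _ (IS _ pI))).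
  + move=> v; rewrite !inE; have [->{v} _|vu /= vI] := eqVneq v u.
      rewrite (negPf uc) addn0; apply: leq_trans (_ : #|[set x; y]| <= _).
        by rewrite cards2 xy.
      apply/subset_leq_card/subsetP=> t; rewrite !inE => txy.
      rewrite txy orbA txy eqxx /= andbT.
      by case/orP: txy => /eqP->; rewrite eq_sym ?Nx ?Ny.
    apply: leq_trans (chP v vI) _.
    apply/subset_leq_card/subsetP=> t; rewrite !inE => /and3P[tS tc /eqP <-].
    by rewrite tS tc !orbT (negPf (Nx _ tS)) (negPf (Ny _ tS)) /=.
Qed.

Lemma hit_sub S I : hit S I -> I \subset S.
Proof. by case/hit_rooted=> c [par [h []]]. Qed.

Section Spanning.
Variables (I : {set V}) (c : V) (par : V -> V) (h : V -> nat).
Hypothesis rootedT : rooted [set: V] I c par h.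

Definition parent_rel : rel V := fun x y =>
  ((x != c) && (par x == y)) || ((y != c) && (par y == x)).

Let parP x : x != c -> [/\ par x \in I, G (par x) x & h (par x) < h x].
Proof. by case: rootedT => _ _ P _; apply: P; rewrite inE. Qed.

Let chP u : u \in I -> 2 + (u == c) <= #|[set x | (x != c) && (par x == u)]|.
Proof.
case: rootedT => _ _ _ P /P; congr (_ <= _); apply: eq_card => x.
by rewrite !inE.
Qed.

Fact parent_sym : symmetric parent_rel.
Proof. by move=> x y; rewrite /parent_rel orbC. Qed.

Fact parent_irrefl : irreflexive parent_rel.
Proof.
move=> x; rewrite /parent_rel orbb; have [->//|xc] := eqVneq x c.
by have [_ /edge_neq/negPf-> _] := parP xc.
Qed.

Definition parent_tree : sgraph V := SGraph parent_sym parent_irrefl.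

Lemma parent_tree_sub : subrel parent_tree G.
Proof.
move=> x y /= /orP[] /andP[/parP[_ Gp _] /eqP <-] //.
by rewrite edge_sym.
Qed.

Lemma parent_tree_connected : connected parent_tree.
Proof.
have toc x : connect parent_tree x c.
  have [k] := ubnP (h x); elim: k x => // k IH x; rewrite ltnS => hx.
  have [->|xc] := eqVneq x c; first exact: connect0.
  have [_ _ hp] := parP xc.
  apply: connect_trans (IH _ (leq_trans hp hx)); apply: connect1.
  by rewrite /= /parent_rel xc eqxx.
move=> x y; apply: connect_trans (toc x) _.
by rewrite (sym_connect_sym parent_sym).
Qed.

(* A vertex of maximal height on a cycle has the same parent as both of its
   neighbours on the cycle. *)
Lemma parent_tree_acyclic : acyclic parent_tree.
Proof.
move=> s s_gt2; apply/negP => /andP[cyc Us].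
have [x0 x0s] : exists x0, x0 \in s.
  by case: s s_gt2 {cyc Us} => // x s _; exists x; rewrite mem_head.
pose m := [arg max_(i > x0 in s) h i].
have [ms mmax] : m \in s /\ forall y, y \in s -> h y <= h m.
  by rewrite /m; case: arg_maxnP.
have up y : y \in s -> parent_rel m y -> y = par m.
  move=> ys /orP[/andP[_ /eqP->]//|/andP[/parP[_ _ hy] /eqP py]].
  by have := leq_trans hy (mmax _ ys); rewrite py ltnn.
have E1 : next s m = par m by apply: up; [rewrite mem_next|exact: (next_cycle cyc)].
have E2 : prev s m = par m.
  by apply: up; [rewrite mem_prev|rewrite parent_sym; exact: (prev_cycle cyc)].
move: ms E1 E2; case/rot_to=> i t Es.
rewrite -(next_rot i) // -(prev_rot i) // Es => E1 E2.
have := s_gt2; have := Us; rewrite -(size_rot i) -(rot_uniq i) Es.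
move: E1 E2; rewrite prev_nth mem_head => E1 E2 /andP[mt Ut].
move: E2; rewrite (memNindex mt) => E2.
case: t mt Ut E1 E2 {Es} => [|a [|b t]] // mt /andP[aN _].
rewrite /= eqxx => <- E2 _; case/negP: aN.
by rewrite -E2 -[nth _ _ _]/(nth m (b :: t) (size t)) mem_nth.
Qed.

Lemma parent_tree_deg v : degree parent_tree v != 2.
Proof.
rewrite /degree /neighbors; have [vI|vI] := boolP (v \in I).
  have := chP vI; rewrite neq_ltn => ch; apply/orP; right.
  have [vc|vc] := eqVneq v c.
    rewrite vc eqxx in ch; apply: leq_trans ch _.
    by apply/subset_leq_card/subsetP=> t; rewrite !inE /= /parent_rel vc => ->; rewrite orbT.
  (* The parent of [v] is not also its child, since each would then be lower than the other; it is
     therefore a third neighbour. *)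
  have pN : par v \notin [set x | (x != c) && (par x == v)].
    rewrite inE; apply/negP=> /andP[pc /eqP ppv].
    have [_ _] := parP vc; have [_ _] := parP pc; rewrite ppv => h1 h2.
    by have := ltn_trans h1 h2; rewrite ltnn.
  apply: leq_trans (_ : #|par v |: [set x | (x != c) && (par x == v)]| <= _).
    by rewrite cardsU1 pN; move: ch; lia.
  apply/subset_leq_card/subsetP=> t; rewrite !inE /= /parent_rel vc.
  by case/orP=> [/eqP->|->]; rewrite ?eqxx ?orbT.
rewrite neq_ltn ltnS; apply/orP; left; rewrite -(cards1 (par v)).
apply/subset_leq_card/subsetP=> t; rewrite !inE /= => /orP[/andP[_ /eqP->]//|].
by case/andP=> /parP[pI _ _] /eqP pt; rewrite pt (negPf vI) in pI.
Qed.

End Spanning.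

Lemma hit_HIST I : hit [set: V] I -> has_HIST G.
Proof.
case/hit_rooted=> c [par [h R]]; exists (parent_tree R); last exact: parent_tree_deg.
split; first exact: parent_tree_sub.
by split; [exact: parent_tree_connected|exact: parent_tree_acyclic].
Qed.

End Trees.

(** * Promotion of vertices to inner vertices *)

Section Growth.
Variables (V : finType) (G : sgraph V).

Notation N := (neighbors G).

(** These are the vertices that the tree can span without any new inner vertex. *)
Definition dominated (S I : {set V}) : {set V} := S :|: \bigcup_(u in I) N u.

Lemma mem_dominated (S I : {set V}) u x : u \in I -> G u x -> x \in dominated S I.
Proof.
by move=> uI ux; rewrite inE; apply/orP; right; apply/bigcupP; exists u; rewrite ?inE.
Qed.

Lemma dominated_subl (S I : {set V}) : S \subset dominated S I.
Proof. exact: subsetUl. Qed.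

Lemma dominated_mono (S S' I I' : {set V}) : S \subset S' -> I \subset I' ->
  dominated S I \subset dominated S' I'.
Proof.
move=> SS II; apply: setUSS => //; apply/bigcupsP=> u uI.
by apply: (bigcup_sup u) => //; exact: subsetP II _ uI.
Qed.

(** A missing vertex has a neighbour in [I] and can be attached there as a leaf; induction on the
    number of missing vertices. *)
Lemma hit_spanning S I : hit G S I -> dominated S I = [set: V] ->
  has_HIST G.
Proof.
have [k] := ubnP #|~: S|; elim: k S => // k IH S Sk hS covS.
have [S0|[x xS]] := set_0Vmem (~: S).
  by apply: (@hit_HIST _ _ I); rewrite -(setCK S) S0 setC0 in hS.
rewrite inE in xS; have: x \in dominated S I by rewrite covS inE.
rewrite inE (negPf xS) /= => /bigcupP[u uI]; rewrite inE => ux.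
apply: IH (hit_attach hS uI xS ux) _.
  by have := cardsC (x |: S); have := cardsC S; rewrite cardsU1 xS /=; lia.
by apply/eqP; rewrite -subTset -covS; apply: dominated_mono; rewrite ?subsetUr.
Qed.

(** A leaf [l] of the tree receives two children outside [S]. A vertex outside [S] is first attached
    as a leaf to its neighbour in [I], so that up to three vertices are added. *)
Lemma promote S I l : hit G S I -> l \in dominated S I -> l \notin I ->
  2 <= #|N l :\: S| ->
  exists S', [/\ hit G S' (l |: I), S \subset S', #|S'| <= #|S| + 3 &
    dominated S I :|: N l \subset dominated S' (l |: I)].
Proof.
move=> hS lC lI /card_gt1P[x [y [xN yN xy]]].
move: xN yN; rewrite !inE => /andP[xS lx] /andP[yS ly].
have U1 z (B : {set V}) : #|z |: B| <= #|B| + 1.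
  by rewrite cardsU1 addnC leq_add2l leq_b1.
have covP (S' : {set V}) : S \subset S' -> dominated S I :|: N l \subset dominated S' (l |: I).
  move=> SS; rewrite subUset dominated_mono ?subsetUr //=.
  by apply/subsetP=> z; rewrite inE; apply: mem_dominated; rewrite setU11.
have [lS|lS] := boolP (l \in S).
  have SS : S \subset x |: (y |: S) by rewrite !subsetU ?subxx ?orbT.
  exists (x |: (y |: S)); split; [exact: hit_grow|by []| |exact: covP].
  by rewrite -[3]/(1 + 1 + 1) !addnA (leq_trans (U1 _ _)) // leq_add2r (leq_trans (U1 _ _)) // leq_addr.
move: lC; rewrite inE (negPf lS) /= => /bigcupP[u uI]; rewrite inE => ul.
have hl := hit_attach hS uI lS ul.
have nl z : G l z -> z \notin S -> z \notin l |: S.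
  by move=> lz zS; rewrite !inE negb_or zS andbT eq_sym (edge_neq lz).
have SS : S \subset x |: (y |: (l |: S)) by rewrite !subsetU ?subxx ?orbT.
exists (x |: (y |: (l |: S))); split=> //; last exact: covP.
  by apply: (hit_grow hl _ lI (nl _ lx xS) (nl _ ly yS) xy lx ly); rewrite setU11.
by rewrite -[3]/(1 + 1 + 1) !addnA; do 2!(apply: leq_trans (U1 _ _) _; rewrite leq_add2r); exact: U1.
Qed.

(** * Growing a small tree that dominates all high vertices *)

Section Main.
Variables (n : nat) (L S0 I0 : {set V}).
Hypotheses (cardV : #|V| = n) (n_ge : 270 <= n).
Hypothesis hit0 : hit G S0 I0.
Hypotheses (S0_le : #|S0| <= 3 * #|I0| + 1) (I0_le : #|I0| <= 2).
Hypothesis NC : forall x y, x != y -> ~~ G x y -> n <= 2 * #|N x :|: N y| + 1.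
Hypothesis high : forall l, l \notin L -> n <= 4 * #|N l| + 1.
(** Compared with [high], the constant 5 leaves room for one neighbour of [x] in [L]. The next
    hypothesis, [link], is the form in which connectivity of [G - L] enters: the growth can always
    continue through a high vertex. *)
Hypothesis high_rest : forall x, x \notin L -> x \notin dominated S0 I0 ->
  n <= 4 * #|N x :\: L| + 5.
Hypothesis link : forall A : {set V}, dominated S0 I0 \subset A ->
  A :|: L != setT ->
  exists l x, [/\ l \in A, l \notin L, x \notin A :|: L & G l x].

Definition rest (S I : {set V}) := ~: (dominated S I :|: L).

(** The size bound is the invariant of promotion, which adds one inner vertex and at most three tree
    vertices. It keeps [S] small, so that vertices of large degree still have neighbours outside
    [S]. *)
Definition state (S I : {set V}) :=
  [/\ hit G S I, dominated S0 I0 \subset dominated S I & #|S| <= 3 * #|I| + 1].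

Lemma rest_notin (S I : {set V}) u x : u \in I -> x \in rest S I -> ~~ G u x.
Proof.
move=> uI; apply: contraL => ux.
by rewrite in_setC in_setU !negbK (mem_dominated _ uI ux).
Qed.

Lemma state_promote S I l : state S I -> l \in dominated S I -> l \notin I ->
  2 <= #|N l :\: S| ->
  exists S', [/\ state S' (l |: I), #|l |: I| = #|I|.+1,
    rest S' (l |: I) \subset rest S I :\: N l & N l \subset dominated S' (l |: I)].
Proof.
case=> hS C0 cS lC lI lN.
have [S' [hS' SS' cS' covS']] := promote hS lC lI lN.
have cI : #|l |: I| = #|I|.+1 by rewrite cardsU1 lI.
exists S'; split=> //.
- split=> //; last by rewrite cI; lia.
  exact: subset_trans (subset_trans C0 (subsetUl _ _)) covS'.
- rewrite /rest setDE -setCU setCS.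
  by apply: subset_trans (setSU L covS'); rewrite setUAC.
- exact: subset_trans (subsetUr _ _) covS'.
Qed.

(** With at most 20 inner vertices the tree has at most 61 vertices, whereas a high vertex has at
    least 68 neighbours, so promotion is possible. If [l] is already inner, nothing has to be
    done. *)
Lemma state_promote_high S I l : state S I -> #|I| <= 20 ->
  l \in dominated S I -> l \notin L ->
  exists S' I', [/\ state S' I', #|I'| <= #|I|.+1,
    rest S' I' \subset rest S I :\: N l, I \subset I' & N l \subset dominated S' I'].
Proof.
move=> stS I20 lC lL; have [lI|lI] := boolP (l \in I).
  exists S, I; split=> //; last first.
    by apply/subsetP=> x; rewrite inE; apply: mem_dominated.
  apply/subsetP=> x xR; rewrite inE xR andbT inE; exact: rest_notin xR.
have [|S' [stS' cI rS' cov]] := @state_promote S I l stS lC lI.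
  case: stS => _ _ cS; have := high lL; have := cardsID S (N l).
  by have := subset_leq_card (subsetIr (N l) S); lia.
by exists S', (l |: I); split; rewrite ?cI ?subsetUr.
Qed.

Definition reach k a := exists S I, [/\ state S I, #|I| <= k &
  1000 * #|rest S I| <= a * n].

Lemma rest_link S I : state S I -> rest S I != set0 ->
  exists l x, [/\ l \in dominated S I, l \notin L, x \in rest S I & G l x].
Proof.
case=> _ C0 _ R0; have [|l [x [lC lL xR lx]]] := link C0.
  by apply: contraNneq R0 => E; rewrite /rest E setCT.
by exists l, x; split=> //; rewrite in_setC.
Qed.

(** Both sides are compared with [c] times the number of edges between [A] and [B]. *)
Lemma double_count (A B : {set V}) (a b c : nat) :
  (forall x, x \in A -> a <= c * #|N x :&: B|) ->
  (forall y, y \in B -> c * #|N y :&: A| <= b) -> a * #|A| <= b * #|B|.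
Proof.
move=> aA bB.
have card_sum (C D : {set V}) :
    \sum_(x in C) #|N x :&: D| = \sum_(x in C) \sum_(y in D) G x y.
  apply: eq_bigr => x _; rewrite -sum1_card big_mkcond [RHS]big_mkcond /=.
  by apply: eq_bigr => y _; rewrite !inE; case: (edge _ _ _); case: (y \in D).
have E : \sum_(x in A) #|N x :&: B| = \sum_(y in B) #|N y :&: A|.
  rewrite !card_sum exchange_big; apply: eq_bigr => y _.
  by apply: eq_bigr => x _; rewrite edge_sym.
rewrite ![_ * #|_|]mulnC -!sum_nat_const.
apply: leq_trans (leq_sum _ aA) _; rewrite -big_distrr E big_distrr /=.
exact: leq_sum.
Qed.

(** After division by 4n the claim reads (750 + a1 - a2) r + 249 r / n < a1 n. As n is at least 270,
    the term 249 r / n is less than r, which is why 751 replaces 750 in the hypothesis. The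
    inequality refutes the edge count at the end of [phase_step]. *)
Lemma table_arith a0 a1 a2 r :
  a0 * (751 + a1) <= 1000 * a1 + a0 * a2 -> a2 <= a1 ->
  1000 * r <= a0 * n -> a1 * n < 1000 * r -> r <= n ->
  (4000 * r - 4 * (a1 * n)) * (n - r) <
  (1000 * n + 4 * (a2 * n) - (996 + 4000 * r)) * r.
Proof.
move=> tab a21 ra0 ra1 rn.
have tab' : a0 * (751 + a1 - a2) <= 1000 * a1.
  by rewrite mulnBr leq_subLR [a0 * a2 + _]addnC.
have rc : (751 + a1 - a2) * r <= a1 * n.
  move: tab' ra0 {tab}; set c := 751 + a1 - a2 => tab' ra0.
  have : c * (1000 * r) <= c * (a0 * n) by rewrite leq_mul2l ra0 orbT.
  have : a0 * c * n <= 1000 * a1 * n by rewrite leq_mul2r tab' orbT.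
  lia.
have {tab tab' ra0} rnn : (751 + a1) * r * n <= a1 * n * n + a2 * r * n.
  rewrite -mulnDl leq_mul2r; apply/orP; right.
  by move: rc; rewrite mulnBl leq_subLR [a2 * r + _]addnC.
have n0 : 270 * r <= n * r by rewrite leq_mul2r n_ge orbT.
have {rc} key : 4000 * r * (n - r) + (996 + 4000 * r) * r <
    (1000 * n + 4 * (a2 * n)) * r + 4 * (a1 * n) * (n - r).
  have [d nE] : exists d, n = r + d by exists (n - r); lia.
  have -> : n - r = d by lia.
  have E1 : 4000 * r * d + 4000 * r * r = 4000 * (n * r) by rewrite nE; lia.
  have E2 : 4 * (a1 * n) * d + 4 * (a1 * r * n) = 4 * (a1 * n * n).
    by rewrite {2 4}nE; nia.
  have E3 : (751 + a1) * r * n = 751 * (n * r) + a1 * r * n by lia.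
  have E4 : (1000 * n + 4 * (a2 * n)) * r = 1000 * (n * r) + 4 * (a2 * r * n) by lia.
  have E5 : (996 + 4000 * r) * r = 996 * r + 4000 * r * r by lia.
  move: rnn n0 E1 E2 E3 E4 E5; lia.
have : (4000 * r - 4 * (a1 * n)) * (n - r) + 4 * (a1 * n) * (n - r) =
  4000 * r * (n - r) by rewrite -mulnDl subnK //; lia.
have : (1000 * n + 4 * (a2 * n)) * r <=
  (1000 * n + 4 * (a2 * n) - (996 + 4000 * r)) * r + (996 + 4000 * r) * r.
  by rewrite -mulnDl leq_mul2r; apply/orP; right; lia.
by move: key; lia.
Qed.

(** The three outcomes correspond to one promotion in [C], to two promotions along an edge from [C]
    to [R], and to three along a path that enters [R] and ends at a vertex with no neighbour in [C].
    If none of them is available, every vertex of [R] has many neighbours in [C] and every vertex of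
    [C] few in [R], against the double count. *)
Lemma phase_step k a0 a1 a2 a3 : k <= 16 ->
  a0 * (751 + a1) <= 1000 * a1 + a0 * a2 -> a2 <= a1 -> a0 <= a3 + 249 ->
  reach k a0 -> [\/ reach k.+1 a1, reach k.+2 a2 | reach k.+3 a3].
Proof.
move=> k16 tab a21 a03 [S [I [stS Ik rS]]].
pose R := rest S I; pose C := dominated S I :\: L.
have := @table_arith a0 a1 a2 #|R| tab a21 rS; move: tab => _ table_R.
have RE z : (z \in R) = (z \notin dominated S I) && (z \notin L).
  by rewrite in_setC in_setU negb_or.
have CE z : (z \in C) = (z \notin L) && (z \in dominated S I) by rewrite in_setD.
have [R0|R0] := eqVneq R set0.
  apply: Or31; exists S, I; split=> //; first exact: leqW.
  by rewrite -/R R0 cards0 muln0.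
have mono (S' I' D : {set V}) m : rest S' I' \subset D -> 1000 * #|D| <= m ->
    1000 * #|rest S' I'| <= m.
  by move=> /subset_leq_card SD; apply: leq_trans; rewrite leq_mul2l SD.
have I20 (I' : {set V}) d : d <= 4 -> #|I'| <= k + d -> #|I'| <= 20.
  by move=> d4 /leq_trans-> //; rewrite (leq_add k16 d4).
have [/existsP[l /andP[]]|/existsPn noA] :=
    boolP [exists l, (l \in C) && (1000 * #|R :\: N l| <= a1 * n)].
  rewrite CE => /andP[lL lC] lr.
  have [|S' [I' [stS' cI rS' _ _]]] := state_promote_high stS _ lC lL.
    by apply: (I20 _ 0); rewrite ?addn0.
  apply: Or31; exists S', I'; split=> //; last exact: mono rS' lr.
  exact: leq_trans cI _.
have [/existsP[x /existsP[l /and4P[xR]]]|noB] :=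
    boolP [exists x, exists l, [&& x \in R, l \in C, G l x &
      1000 * #|R :\: (x |: N x)| <= a2 * n]].
  rewrite CE => /andP[lL lC] lx xr.
  have [|S1 [I1 [stS1 cI1 rS1 _ covl]]] := state_promote_high stS _ lC lL.
    by apply: (I20 _ 0); rewrite ?addn0.
  have xC1 : x \in dominated S1 I1 by apply: (subsetP covl); rewrite inE.
  have xL : x \notin L by move: xR; rewrite RE => /andP[].
  have I1k : #|I1| <= k.+1 by exact: leq_trans cI1 _.
  have [|S2 [I2 [stS2 cI2 rS2 _ _]]] := state_promote_high stS1 _ xC1 xL.
    by apply: (I20 _ 1); rewrite ?addn1.
  apply: Or32; exists S2, I2; split=> //; first exact: leq_trans cI2 _.
  apply: mono xr.
  apply: subset_trans rS2 _; apply/subsetP=> z; rewrite !in_setD in_setU1.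
  case/andP=> zx /(subsetP rS1); rewrite in_setD => /andP[zl zR].
  rewrite (negPf zx) orbF zR andbT; apply: contraNneq zl => ->.
  by rewrite inE.
have [/existsP[y0 /andP[y0R /eqP y0C]]|/existsPn noC] :=
    boolP [exists y, (y \in R) && (N y :&: C == set0)].
  (* The vertex [y0] only shows that [A] and [L] do not exhaust the graph. Then [link] gives an edge
     from [l'] in [A] to a high vertex [y] outside [A]. Since [y] has no neighbour in [C], [l'] lies
     in [R] and has a neighbour [l] in [C]; the vertices [l], [l'], [y] are promoted in this
     order. *)
  pose A := dominated S I :|: [set x in R | N x :&: C != set0].
  have AE z : (z \in A) = (z \in dominated S I) || ((z \in R) && (N z :&: C != set0)).
    by rewrite in_setU [z \in [set _ in _ | _]]inE.
  have [||l' [y [l'A l'L yA l'y]]] := @link A.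
  - by case: stS => _ C0 _; apply: subset_trans C0 (subsetUl _ _).
  - apply/eqP=> /setP/(_ y0).
    rewrite in_setT in_setU AE y0R y0C eqxx andbF orbF => yy.
    by move: y0R; rewrite RE -negb_or yy.
  move: yA; rewrite in_setU AE !negb_or => /andP[/andP[yS yN] yL].
  have yR : y \in R by rewrite RE yS.
  have yC0 : N y :&: C = set0.
    by apply/eqP; move: yN; rewrite yR /= negbK.
  have l'C : l' \notin dominated S I.
    apply/negP=> l'C; have := in_set0 l'; rewrite -yC0 in_setI CE l'C l'L.
    by rewrite inE edge_sym l'y.
  move: l'A; rewrite AE (negPf l'C) /= => /andP[l'R /set0Pn[l]].
  rewrite in_setI inE CE => /and3P[l'l lL lC].
  have [|S1 [I1 [stS1 cI1 rS1 _ covl]]] := state_promote_high stS _ lC lL.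
    by apply: (I20 _ 0); rewrite ?addn0.
  have l'C1 : l' \in dominated S1 I1.
    by apply: (subsetP covl); rewrite inE edge_sym.
  have I1k : #|I1| <= k.+1 by exact: leq_trans cI1 _.
  have [|S2 [I2 [stS2 cI2 rS2 _ covl']]] := state_promote_high stS1 _ l'C1 l'L.
    by apply: (I20 _ 1); rewrite ?addn1.
  have I2k : #|I2| <= k.+2 by exact: leq_trans cI2 _.
  have yC2 : y \in dominated S2 I2 by apply: (subsetP covl'); rewrite inE.
  have [|S3 [I3 [stS3 cI3 rS3 _ _]]] := state_promote_high stS2 _ yC2 yL.
    by apply: (I20 _ 2); rewrite ?addn2.
  have rS3R : rest S3 I3 \subset R :\: (y |: (N y :\: L)).
    apply: subset_trans rS3 _; apply/subsetP=> z.
    rewrite in_setD [z \in R :\: _]in_setD in_setU1 [z \in N y :\: _]in_setD.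
    case/andP=> zy /(subsetP rS2); rewrite in_setD => /andP[zl' /(subsetP rS1)].
    rewrite in_setD => /andP[_ zR]; rewrite zR (negPf zy) andbF orbF andbT.
    by apply: contraNneq zl' => ->; rewrite inE.
  have yNR : y |: (N y :\: L) \subset R.
    rewrite subUset sub1set yR; apply/subsetP=> z; rewrite in_setD => /andP[zL zy].
    rewrite RE zL andbT; apply/negP=> zS.
    by have := in_set0 z; rewrite -yC0 in_setI zy CE zL zS.
  have cy : #|y |: (N y :\: L)| = #|N y :\: L|.+1.
    by rewrite cardsU1 !inE edge_irrefl andbF.
  have yS0 : y \notin dominated S0 I0.
    by apply: contra yS; case: stS => _ /subsetP C0 _; exact: C0.
  have := high_rest yL yS0; have := cardsID (y |: (N y :\: L)) R.
  rewrite (setIidPr yNR) cy => cR hy.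
  apply: Or33; exists S3, I3; split=> //; first exact: leq_trans cI3 _.
  apply: mono rS3R _.
  (* All high neighbours of [y] lie in [R]; together with [y] they number at least (n - 1) / 4,
     which is at least 249 n / 1000 because n is at least 250. *)
  have a03n : a0 * n <= (a3 + 249) * n by rewrite leq_mul2r a03 orbT.
  have Rle : 1000 * #|R| <= (a3 + 249) * n by exact: leq_trans a03n.
  by clear - Rle cR hy n_ge; lia.
have rn : #|R| <= n by rewrite -cardV max_card.
have ra1 : #|C| <= n - #|R|.
  have : C \subset ~: R.
    by apply/subsetP=> z; rewrite CE in_setC RE => /andP[-> ->].
  by move/subset_leq_card; have := cardsC R; rewrite cardV; lia.
have ra1' : a1 * n < 1000 * #|R|.
  have [l [x [lC lL _ _]]] := rest_link stS R0.
  have := noA l; rewrite CE lL lC /= -ltnNge => /leq_trans-> //.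
  by rewrite leq_mul2l subset_leq_card ?orbT // subsetDl.
have := table_R ra1' rn.
rewrite ltnNge => /negP[]; apply: leq_trans (leq_mul (leqnn _) ra1).
have ra2 : a2 * n <= a1 * n by rewrite leq_mul2r a21 orbT.
move: rS ra1' ra2; rewrite -/R.
move: (a0 * n) (a1 * n) (a2 * n) noA noB => b0 b1 b2 noA noB rS rb1 rb2.
clear table_R a21 a03.
(* The factor 4000 clears the denominators 4 and 1000. In the lower bound, 996 is 5000 - 4000 - 4,
   from the constant 5 of [high_rest], the vertex [x] itself, and the strictness of the negated
   second case. *)
apply: (@double_count R C _ _ 4000) => [x xR|l lC]; last first.
  have := noA l; rewrite lC /= -ltnNge; have := cardsID (N l) R.
  by rewrite setIC; lia.
have /andP[xS xL] : (x \notin dominated S I) && (x \notin L) by rewrite -RE.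
have := noC x; rewrite xR /= => /set0Pn[l]; rewrite in_setI inE => /andP[xl lC].
move/existsPn/(_ x)/existsPn/(_ l): noB; rewrite xR lC edge_sym xl /= -ltnNge.
have xS0 : x \notin dominated S0 I0.
  by apply: contra xS; case: stS => _ /subsetP C0 _; exact: C0.
have := high_rest xL xS0.
have xRx : #|R :&: (x |: N x)| = #|N x :&: R|.+1.
  have -> : R :&: (x |: N x) = x |: (N x :&: R).
    apply/setP=> z; rewrite in_setU1 !in_setI in_setU1 andbC.
    by have [->|_] := eqVneq z x.
  by rewrite cardsU1 in_setI inE edge_irrefl.
have := cardsID (x |: N x) R; rewrite xRx.
have : #|N x :\: L| <= #|N x :&: R| + #|N x :&: C|.
  apply: leq_trans (leq_card_setU _ _); apply/subset_leq_card/subsetP=> z.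
  rewrite in_setD => /andP[zL zx]; rewrite in_setU !in_setI zx RE CE zL /=.
  by rewrite andbT orNb.
lia.
Qed.

(* Bounds, per mille of n, on the number of unreached high vertices when there
   are 3, 4, 5, ... inner vertices; the entries satisfy the hypotheses of
   [phase_step]. *)
Definition table := [:: 750; 667; 584; 501; 418; 345; 281; 227; 181; 143; 112;
  87; 67; 52; 40; 31].

(** A phase moves as many positions along the table as it spends inner vertices, so position [i]
    costs [3 + i] of them. The induction is on the distance to position 13, whose entry is 52. *)
Lemma reach_table : reach 3 750 -> reach 18 52.
Proof.
have tabP i : i < 13 -> let a j := nth 0 table (i + j) in
    [/\ a 0 * (751 + a 1) <= 1000 * a 1 + a 0 * a 2, a 2 <= a 1 & a 0 <= a 3 + 249].
  by do 13!(case: i => [|i]; first by move=> _; split; rewrite /table /=; lia).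
have: forall d i, i + d = 13 -> reach (3 + i) (nth 0 table i) -> reach 18 52.
  move=> d; have [m] := ubnP d; elim: m d => // m IH d dm i id.
  have [d0|d0] := posnP d.
    rewrite d0 addn0 in id; rewrite id => -[S [I [stS cI rS]]].
    by exists S, I; split=> //; lia.
  have [|t1 t2 t3] := tabP i; first lia.
  rewrite addn0 in t1 t3.
  (* The last phase may overshoot to position 14 or 15, where the entry is below 52 and at most 3 +
     15 = 18 inner vertices are used. *)
  have fin j : 13 <= j -> j <= 15 -> reach (3 + j) (nth 0 table j) -> reach 18 52.
    move=> j1 j2 [S [I [stS cI rS]]]; exists S, I; split=> //; first lia.
    apply: leq_trans rS _; rewrite leq_mul2r; apply/orP; right.
    by have : j \in iota 13 3; [rewrite mem_iota; lia|move/(nthP 0)=> [[|[|[|]]] //= _ <-]].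
  have nxt j : j <= 3 -> 0 < j -> reach (3 + (i + j)) (nth 0 table (i + j)) -> reach 18 52.
    move=> j3 j0 r; have [le|gt] := leqP (i + j) 13; last by apply: fin r; lia.
    by apply: (IH (d - j) _ (i + j)) r; lia.
  case/(phase_step _ t1 t2 t3) => [|r|r|r]; first lia.
  - by apply: (nxt 1) => //; rewrite addn1 in r *.
  - by apply: (nxt 2) => //; rewrite addn2 in r *.
  - by apply: (nxt 3) => //; rewrite addn3 in r *.
by move=> H; apply: (H 13 0).
Qed.

(** One promotion of a high vertex reaches it and its at least (n - 1) / 4 neighbours, leaving at
    most three quarters of the graph. *)
Lemma reach_start : reach 3 750.
Proof.
have st0 : state S0 I0 by split.
have [R0|R0] := eqVneq (rest S0 I0) set0.
  by exists S0, I0; split=> //; [lia|rewrite R0 cards0; lia].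
have [l [x [lC lL xR lx]]] := rest_link st0 R0.
have [|S1 [I1 [stS1 cI1 rS1 _ covl]]] := state_promote_high st0 _ lC lL; first lia.
exists S1, I1; split=> //; first lia.
have : rest S1 I1 \subset ~: (l |: N l).
  apply: subset_trans rS1 _; apply/subsetP=> z; rewrite in_setD in_setC in_setU1.
  case/andP=> /negPf-> zR; rewrite orbF; apply: contraTneq zR => ->.
  by rewrite in_setC in_setU lC.
move/subset_leq_card; have := cardsC (l |: N l); rewrite cardV cardsU1.
by rewrite inE edge_irrefl /=; have := high lL; lia.
Qed.

(** Each promotion of a reached neighbour of an unreached [x] costs one inner vertex and removes at
    least [x], so the sum bounded by [B] does not grow. When no such promotion is possible, the set
    [Q] of reached high neighbours of [x] is a clique of leaves, and is too large for that. *)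
Lemma endgame B S I : state S I -> #|I| + #|rest S I| <= B -> 8 * B + 5 <= n ->
  exists S' I', [/\ state S' I', #|I'| <= B & rest S' I' = set0].
Proof.
have [m] := ubnP #|rest S I|; elim: m S I => // m IH S I rm stS IB Bn.
have [R0|R0] := eqVneq (rest S I) set0.
  by exists S, I; split=> //; lia.
have [x xR] := set0Pn _ R0.
have [xL xS] : x \notin L /\ x \notin dominated S I.
  by move: xR; rewrite in_setC in_setU negb_or => /andP[].
have [IS leafS] : I \subset S /\ #|S :\: I| <= 2 * #|I| + 1.
  case: stS => /hit_sub IS _ cS; split=> //.
  by have := cardsID I S; rewrite (setIidPr IS); lia.
pose Q := N x :&: (dominated S I :\: L).
have QI l : l \in Q -> l \notin I.
  rewrite in_setI inE => /andP[xl _]; apply: contraL xR => lI.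
  by apply: contraL (xl); rewrite edge_sym; exact: rest_notin.
have [/existsP[l /andP[lQ lN]]|/existsPn noP] :=
    boolP [exists l, (l \in Q) && (2 <= #|N l :\: S|)].
  have lC : l \in dominated S I by move: lQ; rewrite in_setI in_setD => /and3P[].
  have [S' [stS' cI rS' _]] := state_promote stS lC (QI _ lQ) lN.
  have lt : #|rest S' (l |: I)| < #|rest S I|.
    apply: proper_card; apply: sub_proper_trans rS' _; apply/properP.
    split; first exact: subsetDl.
    exists x => //; rewrite in_setD inE edge_sym.
    by move: lQ; rewrite in_setI inE => /andP[->].
  by apply: IH stS' _ Bn; rewrite ?cI; lia.
(* Since [l] cannot be promoted, [x] is its only neighbour outside [S]. Two nonadjacent members of
   [Q] would thus have at most |S| + 1 neighbours altogether, too few for [NC]. *)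
have QN l : l \in Q -> N l \subset x |: S.
  move=> lQ; have := noP l; rewrite lQ /= -ltnNge ltnS.
  move/card_le1_eqP => Nl; apply/subsetP=> z zl; rewrite in_setU1.
  have [//|zS] := boolP (z \in S); first by rewrite orbT.
  rewrite orbF; apply/eqP; apply: Nl; rewrite in_setD ?zS //.
  move: lQ; rewrite in_setI [x \in N l]inE edge_sym inE => /andP[-> _].
  by rewrite andbT; apply: contra xS; exact: subsetP (dominated_subl S I) x.
have Qclique l l' : l \in Q -> l' \in Q -> l != l' -> G l l'.
  move=> lQ l'Q ll'; apply/idPn=> nG; have := NC ll' nG.
  have : #|N l :|: N l'| <= #|x |: S|.
    by apply: subset_leq_card; rewrite subUset !QN.
  case: stS => _ _ cS; rewrite cardsU1; case: (x \notin S) => /=; clear -cS IB Bn n_ge; lia.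
(* At least (n - 5) / 4 >= 2B high neighbours of [x] exist, and fewer than |rest| of them are
   unreached. *)
have cQ : 2 * #|I| + 1 < #|Q|.
  have xS0 : x \notin dominated S0 I0.
    by apply: contra xS; case: stS => _ /subsetP C0 _; exact: C0.
  have := high_rest xL xS0.
  have : #|N x :\: L| <= #|rest S I :\ x| + #|Q|.
    apply: leq_trans (leq_card_setU _ _); apply/subset_leq_card/subsetP=> z.
    rewrite in_setD => /andP[zL zx]; rewrite in_setU in_setI zx in_setD1 /=.
    rewrite !in_setC in_setU in_setD zL (negPf zL) orbF /= andbC.
    have -> : z != x by rewrite eq_sym (@edge_neq _ G) //; move: zx; rewrite inE.
    by rewrite andbT orNb.
  have := cardsD1 x (rest S I); rewrite xR; lia.
(* Any [l] in [Q] is adjacent to another member of the clique, whose neighbours all lie in [S] or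
   equal [x]. *)
have : Q \subset S :\: I.
  apply/subsetP=> l lQ; rewrite in_setD QI //=.
  have /card_gt1P[l1 [l2 [l1Q l2Q l12]]] : 1 < #|Q| by lia.
  have [l' [l'Q l'l]] : exists l', l' \in Q /\ l' != l.
    have [E|] := eqVneq l1 l; last by exists l1.
    by exists l2; rewrite eq_sym -E.
  have /(subsetP (QN _ l'Q)) : l \in N l' by rewrite inE Qclique.
  rewrite in_setU1 => /orP[/eqP lx|//].
  by move: lQ; rewrite lx in_setI inE edge_irrefl.
by move/subset_leq_card; lia.
Qed.

Theorem hit_dominating : exists S I,
  [/\ hit G S I, #|S| <= 3 * #|I| + 1, 8 * #|I| + 5 <= n,
      dominated S0 I0 \subset dominated S I & dominated S I :|: L = setT].
Proof.
have [S [I [stS cI rS]]] := reach_table reach_start.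
(* With |I| <= 18 and |rest| <= 52 n / 1000, the quantity 8B + 5 is at most 149 + 0.416 n, which is
   below n for n at least 270. *)
have [||S' [I' [[hS C0 cS] cI' r0]]] := @endgame (#|I| + #|rest S I|) S I stS.
- by [].
- by lia.
exists S', I'; split=> //; first lia.
by rewrite -[LHS]setCK [X in ~: X]r0 setC0.
Qed.

End Main.
End Growth.

(** * Graphs without a HIST *)

Lemma connected_cut (V : finType) (T : sgraph V) (A : {set V}) a b :
  connected T -> a \in A -> b \notin A ->
  exists x y, [/\ x \in A, y \notin A & T x y].
Proof.
move=> conT aA bA.
have [/existsP[x /existsP[y /and3P[]]]|noE] :=
    boolP [exists x, exists y, [&& x \in A, y \notin A & T x y]].
  by exists x, y.
case/negP: bA; case/connectP: (conT a b) => p pT ->{b}.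
elim: p a aA pT => //= y p IH a aA /andP[ay pT]; apply: IH pT.
apply: contraR noE => yA; apply/existsP; exists a; apply/existsP; exists y.
by rewrite aA yA.
Qed.

Lemma third_neighbor (V : finType) (T : sgraph V) x p q :
  degree T x != 2 -> T x p -> T x q -> p != q ->
  exists r, [/\ T x r, r != p & r != q].
Proof.
move=> dx xp xq pq; have [|[r]] := set_0Vmem (neighbors T x :\: [set p; q]).
  move/eqP; rewrite setD_eq0 => sub; case/eqP: dx; rewrite /degree.
  have -> : neighbors T x = [set p; q].
    by apply/eqP; rewrite eqEsubset sub subUset !sub1set !inE xp.
  by rewrite cards2 pq.
by rewrite !inE negb_or => /andP[/andP[rp rq] xr]; exists r.
Qed.

(** * Transport of trees along an isomorphism *)

Section Transport.
Variables (V W : finType) (f : V -> W) (g : W -> V).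
Hypotheses (fK : cancel f g) (gK : cancel g f).
Variable T : sgraph V.

Fact transport_sym : symmetric (fun x y => T (g x) (g y)).
Proof. by move=> x y; rewrite edge_sym. Qed.

Fact transport_irrefl : irreflexive (fun x y => T (g x) (g y)).
Proof. by move=> x; rewrite edge_irrefl. Qed.

Definition transport : sgraph W := SGraph transport_sym transport_irrefl.

Lemma transport_connected : connected T -> connected transport.
Proof.
move=> conT x y; have /connectP[p pT yE] := conT (g x) (g y).
apply/connectP; exists (map f p); last by rewrite -(gK x) last_map -yE gK.
elim: p {y yE} x pT => //= z p IH x /andP[xz pT].
by rewrite fK xz; apply: IH; rewrite fK.
Qed.

Lemma transport_acyclic : acyclic T -> acyclic transport.
Proof.
move=> acT s s_gt2; have := acT (map g s); rewrite size_map => /(_ s_gt2).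
apply: contra => /andP[cs us]; apply/andP; split.
  by case: s cs {s_gt2 us} => //= x s; rewrite -map_rcons path_map.
by rewrite map_inj_uniq //; exact: can_inj gK.
Qed.

Lemma transport_degree x : degree transport x = degree T (g x).
Proof.
rewrite /degree -(card_imset _ (can_inj gK)); apply: eq_card => y.
apply/imsetP/idP => [[z zx ->]|]; first by move: zx; rewrite !inE.
by exists (f y); rewrite ?fK // inE /= fK; rewrite inE in H.
Qed.

End Transport.

Lemma isomorphic_HIST (V W : finType) (G : sgraph V) (H : sgraph W) :
  isomorphic G H -> has_HIST G -> has_HIST H.
Proof.
case=> f [g fK gK] fG [T [TG [conT acT]] dT].
exists (transport g T); last by move=> x; rewrite (transport_degree fK gK).
split; last by split; [exact: transport_connected fK gK _ _|exact: transport_acyclic].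
by move=> x y /TG; rewrite -fG !gK.
Qed.

(** A spanning tree contains the only edge at [x] and, to reach a third vertex, the other edge at
    [y]; so [y] has degree 2 in it. *)
Lemma HIST_no_pendant (V : finType) (G : sgraph V) :
  2 < #|V| -> has_HIST G -> ~ pendant_adjacent_to_degree_2 G.
Proof.
move=> V3 [T [TG [conT _]] dT] [x [y [dx dy xy]]].
have [z] : exists z, z \in ~: [set x; y].
  apply/set0Pn; rewrite -card_gt0; have := cardsC [set x; y].
  by rewrite cards2; lia.
rewrite !inE negb_or => /andP[zx zy].
have Nx w : G x w -> w = y.
  move/eqP/cards1P: dx => [u Nu]; have : w \in neighbors G x -> w = u by rewrite Nu inE => /eqP.
  have : y \in neighbors G x -> y = u by rewrite Nu inE => /eqP.
  by rewrite !inE => /(_ xy) -> H /H.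
have Txy : T x y.
  have [|u [w [ux wx uw]]] := @connected_cut _ T [set x] x y conT (set11 x).
    by rewrite inE eq_sym (edge_neq xy).
  by move: ux uw; rewrite inE => /eqP-> xw; rewrite -(Nx w) // TG.
have [u [w [uA wA uw]]] : exists u w, [/\ u \in [set x; y], w \notin [set x; y] & T u w].
  apply: (@connected_cut _ T _ x z conT); first by rewrite set21.
  by rewrite !inE negb_or zx.
have uy : u = y.
  move: uA uw wA; rewrite !inE => /orP[/eqP->|/eqP//] /TG/Nx->.
  by rewrite eqxx orbT.
subst u; case/eqP: (dT y); apply/eqP; rewrite eqn_leq; apply/andP; split.
  by rewrite -dy; apply/subset_leq_card/subsetP=> v; rewrite !inE; exact: TG.
apply: leq_trans (_ : #|[set x; w]| <= _).
  by move: wA; rewrite cards2 !inE negb_or eq_sym => /andP[->].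
by apply/subset_leq_card/subsetP=> v; rewrite !inE => /orP[/eqP->|/eqP->//]; rewrite edge_sym.
Qed.

(** A spanning tree has an edge from [v] into each of the two components of [G - v], and [v] has no
    further edges. *)
Lemma HIST_no_H1 (n : nat) (V : finType) (G : sgraph V) :
  type_H1 n G -> ~ has_HIST G.
Proof.
case=> _ _ _ _ [v [_ dv comp2 _]] [T [TG [conT _]] dT].
set D := delete_vertex G v in comp2 *.
have eqD : {in [set: _] & &, equivalence_rel (connect D)}.
  move=> x y z _ _ _; split=> // xy.
  exact: (same_connect (sym_connect_sym (edge_sym D)) xy).
have /card_gt1P[C1 [C2 [C1P C2P C12]]] : 1 < #|components D| by rewrite comp2.
have partD := equivalence_partitionP eqD.
have nonempty C : C \in components D -> exists x, x \in C.
  move=> CP; apply/set0Pn; apply: contraTneq CP => ->.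
  by case/and3P: partD.
have [a aC1] := nonempty _ C1P; have [b bC2] := nonempty _ C2P.
have ab : ~~ connect D a b.
  apply: contra C12 => ab; have tI : trivIset (components D) by case/and3P: partD.
  rewrite -(def_pblock tI C1P aC1) -(def_pblock tI C2P bC2); apply/eqP.
  apply/esym/same_pblock => //.
  by rewrite (pblock_equivalence_partition eqD) ?inE.
pose K (z : {x | x \in [set~ v]}) := [set val y | y in connect D z].
have nbr z z' : ~~ connect D z z' -> exists2 y, y \in K z & T v y.
  move=> zz'; have [|x [y [xK yK xy]]] := @connected_cut _ T (K z) (val z) (val z') conT (imset_f _ (connect0 _ _)).
    by apply: contra zz' => /imsetP[y zy /val_inj->].
  have [yv|yv] := eqVneq y v; first by exists x; rewrite // edge_sym -yv.
  case/negP: yK; case/imsetP: xK => x' zx' xE.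
  have yD : y \in [set~ v] by rewrite !inE.
  apply/imsetP; exists (Sub y yD) => //; apply: connect_trans zx' _; apply: connect1.
  by rewrite /= /induced_rel /= -xE TG.
have [p pK vp] := nbr a b ab; have [q qK vq] : exists2 y, y \in K b & T v y.
  by apply: (nbr b a); rewrite (sym_connect_sym (edge_sym D)).
have pq : p != q.
  apply: contra ab => /eqP pq; subst q.
  case/imsetP: pK qK => p' ap -> /imsetP[q' bq /val_inj pq'].
  apply: connect_trans ap _; rewrite pq' (sym_connect_sym (edge_sym D)).
  exact: bq.
case/eqP: (dT v); apply/eqP; rewrite eqn_leq; apply/andP; split.
  by rewrite -dv; apply/subset_leq_card/subsetP=> w; rewrite !inE; exact: TG.
apply: leq_trans (_ : #|[set p; q]| <= _); first by rewrite cards2 pq.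
by apply/subset_leq_card/subsetP=> w; rewrite !inE => /orP[/eqP->|/eqP->].
Qed.

(** * Spanning trees in graphs of types H2 and H3 *)

Section TypesH2H3.
Variables (m : nat) (u1 u2 u3 : 'I_m).

Let a : H_vertex m := inG0 m v1.
Let b : H_vertex m := inG0 m v2.
Let c : H_vertex m := inG0 m v3.
Let G1 : {set H_vertex m} := [set inG1 x | x : 'I_m].
Let G2 : {set H_vertex m} := [set inG2 x | x : 'I_m].

Let inG1P x : (inG1 x \in G1) * (inG2 x \in G1 = false).
Proof. by split; [rewrite imset_f|apply/negP=> /imsetP[y _]]. Qed.

Let inG2P x : (inG2 x \in G2) * (inG1 x \in G2 = false).
Proof. by split; [rewrite imset_f|apply/negP=> /imsetP[y _]]. Qed.

Let inG0P i : (inG0 m i \in G1 = false) * (inG0 m i \in G2 = false).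
Proof. by split; apply/negP=> /imsetP[y _]. Qed.

Variant vertex_spec : H_vertex m -> Type :=
| Vertex_a : vertex_spec a
| Vertex_b : vertex_spec b
| Vertex_c : vertex_spec c
| Vertex_1 x : vertex_spec (inG1 x)
| Vertex_2 x : vertex_spec (inG2 x).

Let vertexP x : vertex_spec x.
Proof.
case: x => [[[|[|[|//]]] lt3]|[x|x]]; try by constructor.
- by rewrite (_ : Ordinal lt3 = v1); [exact: Vertex_a|exact: val_inj].
- by rewrite (_ : Ordinal lt3 = v2); [exact: Vertex_b|exact: val_inj].
- by rewrite (_ : Ordinal lt3 = v3); [exact: Vertex_c|exact: val_inj].
Qed.

Variable T : sgraph (H_vertex m).
Hypotheses (conT : connected T) (acT : acyclic T).
Hypothesis dT : forall x, degree T x != 2.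

Let ab : a != b. Proof. by []. Qed.

Ltac incident := case/vertexP=> [|||y|y];
  rewrite /= /add_edge_rel /= /add_edge_rel /= /add_edge_rel /= ?orbF ?andbF ?inG1P ?inG2P //;
  try (move/eqP->); by rewrite ?inE ?eqxx ?orbT.

(** The tree contains the edges joining [a] to [G1] and [b] to [G2]. If it contains [a b], avoiding
    degree 2 at [a] and at [b] forces [a c] and [b c], and then [c] has degree 2. Otherwise [G1] is
    left through [a c], and degree 2 at [a] can only be avoided by [a b]. *)
Lemma H2_tree_false : subrel T (H2_graph u1 u2) -> False.
Proof.
move=> TG.
have Na x : T a x -> x \in [:: b; c; inG1 u1].
  by move/TG; move: x; incident.
have Nb x : T b x -> x \in [:: a; c; inG2 u2].
  by move/TG; move: x; incident.
have Nc x : T c x -> x \in [:: a; b].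
  by move/TG; move: x; incident.
have N1 x y : T (inG1 x) y -> y \notin G1 -> y = a.
  by move/TG; move: y; incident.
have N2 x y : T (inG2 x) y -> y \notin G2 -> y = b.
  by move/TG; move: y; incident.
have [d [dG ad]] : exists d, d \in G1 /\ T a d.
  have [||_ [y [/imsetP[x _ ->] yG xy]]] := @connected_cut _ T G1 (inG1 u1) a conT.
  - by rewrite inG1P.
  - by rewrite inG0P.
  by exists (inG1 x); rewrite inG1P edge_sym -(N1 _ _ xy yG).
have [e [eG be]] : exists e, e \in G2 /\ T b e.
  have [||_ [y [/imsetP[x _ ->] yG xy]]] := @connected_cut _ T G2 (inG2 u2) b conT.
  - by rewrite inG2P.
  - by rewrite inG0P.
  by exists (inG2 x); rewrite inG2P edge_sym -(N2 _ _ xy yG).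
have bd : b != d by apply: contraTneq dG => <-; rewrite inG0P.
have cd : c != d by apply: contraTneq dG => <-; rewrite inG0P.
have ae : a != e by apply: contraTneq eG => <-; rewrite inG0P.
have aT := Na _ ad; rewrite !inE ![d == _]eq_sym (negPf bd) (negPf cd) /= in aT.
have [Tab|Tab] := boolP (T a b).
  have [r [ar rb rd]] := third_neighbor (dT a) Tab ad bd.
  move: (Na _ ar); rewrite !inE (negPf rb) (eqP aT) (negPf rd) orbF => /eqP rc.
  subst r; have Tba : T b a by rewrite edge_sym.
  have [r [br ra re]] := third_neighbor (dT b) Tba be ae.
  have bT := Nb _ be; have cNe : c != e by apply: contraTneq eG => <-; rewrite inG0P.
  rewrite !inE ![e == _]eq_sym (negPf ae) (negPf cNe) /= in bT.
  move: (Nb _ br); rewrite !inE (negPf ra) (eqP bT) (negPf re) orbF => /eqP rc.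
  subst r; rewrite edge_sym in ar; rewrite edge_sym in br.
  have [r [/Nc cr r1 r2]] := third_neighbor (dT c) ar br ab.
  by move: cr; rewrite !inE (negPf r1) (negPf r2).
have [||x [y [xA yA xy]]] := @connected_cut _ T (a |: G1) a b conT.
- by rewrite setU11.
- by rewrite in_setU1 eq_sym (negPf ab) inG0P.
move: yA; rewrite in_setU1 negb_or => /andP[ya yG].
move: xA; rewrite in_setU1 => /orP[/eqP xa|/imsetP[x' _ xE]]; last first.
  by rewrite xE in xy; rewrite (N1 _ _ xy yG) eqxx in ya.
subst x; move: (Na _ xy); rewrite !inE => /or3P[/eqP yb|/eqP yc|/eqP yd].
- by rewrite yb (negPf Tab) in xy.
- subst y; have [r [ar rc rd]] := third_neighbor (dT a) xy ad cd.
  move: (Na _ ar); rewrite !inE (negPf rc) (eqP aT) (negPf rd) !orbF => /eqP rb.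
  by rewrite rb (negPf Tab) in ar.
by rewrite yd inG1P in yG.
Qed.

(** Leaving [G1] and avoiding degree 2 at [a] forces both [a b] and [a c], so acyclicity excludes
    [b c]. The tree enters [G2] from [b] or [c], and that vertex has degree 2 because its only other
    edge is [b c]. *)
Lemma H3_tree_false : subrel T (H3_graph u1 u2 u3) -> False.
Proof.
move=> TG.
have Na x : T a x -> x \in [:: b; c; inG1 u1].
  by move/TG; move: x; incident.
have Nb x : T b x -> x \in [:: a; c; inG2 u2].
  by move/TG; move: x; incident.
have Nc x : T c x -> x \in [:: a; b; inG2 u3].
  by move/TG; move: x; incident.
have N1 x y : T (inG1 x) y -> y \notin G1 -> y = a.
  by move/TG; move: y; incident.
have N2 x y : T (inG2 x) y -> y \notin G2 -> y \in [:: b; c].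
  by move/TG; move: y; incident.
have [d [dG ad]] : exists d, d \in G1 /\ T a d.
  have [||_ [y [/imsetP[x _ ->] yG xy]]] := @connected_cut _ T G1 (inG1 u1) a conT.
  - by rewrite inG1P.
  - by rewrite inG0P.
  by exists (inG1 x); rewrite inG1P edge_sym -(N1 _ _ xy yG).
have bd : b != d by apply: contraTneq dG => <-; rewrite inG0P.
have cd : c != d by apply: contraTneq dG => <-; rewrite inG0P.
have aT := Na _ ad; rewrite !inE ![d == _]eq_sym (negPf bd) (negPf cd) /= in aT.
have [Tab Tac] : T a b /\ T a c.
  have [||x [y [xA yA xy]]] := @connected_cut _ T (a |: G1) a b conT.
  - by rewrite setU11.
  - by rewrite in_setU1 eq_sym (negPf ab) inG0P.
  move: yA; rewrite in_setU1 negb_or => /andP[ya yG].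
  move: xA; rewrite in_setU1 => /orP[/eqP xa|/imsetP[x' _ xE]]; last first.
    by rewrite xE in xy; rewrite (N1 _ _ xy yG) eqxx in ya.
  subst x; move: (Na _ xy); rewrite !inE => /or3P[/eqP yb|/eqP yc|/eqP yd].
  - subst y; have [r [ar rb rd]] := third_neighbor (dT a) xy ad bd.
    move: (Na _ ar); rewrite !inE (negPf rb) (eqP aT) (negPf rd) orbF => /eqP rc.
    by rewrite -rc.
  - subst y; have [r [ar rc rd]] := third_neighbor (dT a) xy ad cd.
    move: (Na _ ar); rewrite !inE (negPf rc) (eqP aT) (negPf rd) !orbF => /eqP rb.
    by rewrite -rb.
  by rewrite yd inG1P in yG.
have Tbc : ~~ T b c.
  apply/negP=> Tbc; have /negP := acT (c := [:: a; b; c]) isT; apply.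
  by rewrite /ucycleb /= Tab Tbc edge_sym Tac.
have [||x [y [xA yA xy]]] := @connected_cut _ T G2 (inG2 u2) a conT.
- by rewrite inG2P.
- by rewrite inG0P.
have xb : a != x by apply: contraTneq xA => <-; rewrite inG0P.
have xc i : x != inG0 m i by apply: contraTneq xA => ->; rewrite inG0P.
have x' : exists x', x = inG2 x' by case/imsetP: xA => x' _ ->; exists x'.
have {N2} : y \in [:: b; c] by case: x' xy yA => {}x' -> /N2 H /H.
rewrite !inE => /orP[/eqP yb|/eqP yc]; subst y.
  rewrite edge_sym in Tab; rewrite edge_sym in xy.
  have [r [br ra rx]] := third_neighbor (dT b) Tab xy xb.
  move: (Nb _ xy); rewrite !inE !(negPf (xc _)) /= => /eqP xE.
  move: (Nb _ br); rewrite !inE (negPf ra) -xE (negPf rx) orbF => /eqP rc.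
  by rewrite -rc br in Tbc.
rewrite edge_sym in Tac; rewrite edge_sym in xy.
have [r [cr ra rx]] := third_neighbor (dT c) Tac xy xb.
move: (Nc _ xy); rewrite !inE !(negPf (xc _)) /= => /eqP xE.
move: (Nc _ cr); rewrite !inE (negPf ra) -xE (negPf rx) orbF => /eqP rb.
by rewrite -rb edge_sym cr in Tbc.
Qed.

End TypesH2H3.

(** * Recognizing the graphs of types H1, H2 and H3 *)

Lemma complete_isomorphic (W : finType) (K : sgraph W) m :
  #|W| = m -> (forall x y, x != y -> K x y) -> isomorphic K (complete m).
Proof.
move=> cW clK; exists (fun x => cast_ord cW (enum_rank x)).
  apply: (bij_comp (f := cast_ord cW) (h := enum_rank)); last exact: enum_rank_bij.
  by exists (cast_ord (esym cW)); [exact: cast_ordK|exact: cast_ordKV].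
move=> x y; rewrite /= /complete_rel (inj_eq (@cast_ord_inj _ _ cW)).
rewrite (inj_eq enum_rank_inj); apply/idP/idP; first exact: clK.
exact: edge_neq.
Qed.

Lemma isomorphic_refl (V : finType) (G : sgraph V) : isomorphic G G.
Proof. by exists id => //; exists id. Qed.


Section Realization.
Variables (V : finType) (G : sgraph V) (n : nat).
Hypotheses (conG : connected G) (cardV : #|V| = n) (n_ge : 5 <= n).

Notation N := (neighbors G).

(** Since [X] and [Y] are cliques without edges between them, connectivity in [G - v] means lying on
    the same side, so the two sides are the components. *)
Lemma type_H1_intro (v : V) (X Y : {set V}) m :
  degree G v = 2 -> X :|: Y = [set~ v] -> [disjoint X & Y] ->
  #|X| = m -> #|Y| = m -> 0 < m -> n = m.*2.+1 ->
  (forall a b, a \in X -> b \in X -> a != b -> G a b) ->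
  (forall a b, a \in Y -> b \in Y -> a != b -> G a b) ->
  (forall a b, a \in X -> b \in Y -> ~~ G a b) ->
  type_H1 n G.
Proof.
move=> dv XYv dXY cX cY m0 nm clX clY nXY.
set D := delete_vertex G v.
have conE a b : connect D a b = ((val a \in X) == (val b \in X)).
  have inY (z : {x | x \in [set~ v]}) : val z \notin X -> val z \in Y.
    have : val z \in X :|: Y by rewrite XYv (valP z).
    by rewrite in_setU; case: (_ \in X).
  apply/idP/idP=> [|abX].
    case/connectP=> p pD ->{b}; elim: p a pD => //= b p IH a /andP[ab /IH/eqP<-].
    move: ab; rewrite /induced_rel /= => ab.
    have [aX|/inY aY] := boolP (val a \in X); have [bX|/inY bY] := boolP (val b \in X) => //.
      by rewrite (negPf (nXY _ _ aX bY)) in ab.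
    by rewrite edge_sym (negPf (nXY _ _ bX aY)) in ab.
  have [->|ab] := eqVneq a b; first exact: connect0.
  apply: connect1; rewrite /= /induced_rel /=.
  have [aX|aX] := boolP (val a \in X); have [bX|bX] := boolP (val b \in X).
  - exact: clX.
  - by rewrite aX (negPf bX) in abX.
  - by rewrite (negPf aX) bX in abX.
  - by apply: clY; rewrite ?inY.
pose X' : {set {x | x \in [set~ v]}} := [set a | val a \in X].
pose Y' : {set {x | x \in [set~ v]}} := [set a | val a \in Y].
have XY' a : (a \in Y') = ~~ (val a \in X).
  rewrite inE; have : val a \in X :|: Y by rewrite XYv (valP a).
  rewrite in_setU.
  have [aX|//] := boolP (val a \in X).
  by rewrite (disjointFr dXY aX).
have card_sub (Z : {set V}) : Z \subset [set~ v] ->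
    #|[set a : {x | x \in [set~ v]} | val a \in Z]| = #|Z|.
  move=> /subsetP Zv; rewrite -(card_imset _ val_inj); apply: eq_card => z.
  apply/imsetP/idP => [[a aZ ->]|zZ]; first by rewrite inE in aZ.
  by exists (Sub z (Zv z zZ)); rewrite ?inE.
have cX' : #|X'| = m by rewrite card_sub // -XYv subsetUl.
have cY' : #|Y'| = m by rewrite card_sub // -XYv subsetUr.
have [x0 x0X] : exists x, x \in X' by apply/set0Pn; rewrite -card_gt0 cX'.
have [y0 y0Y] : exists x, x \in Y' by apply/set0Pn; rewrite -card_gt0 cY'.
have XY'N : X' != Y'.
  by apply/eqP=> /setP/(_ x0); rewrite XY'; move: x0X; rewrite inE => ->.
have compE : components D = [set X'; Y'].
  apply/setP=> C; rewrite in_set2; apply/imsetP/orP => [[a _ ->]|].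
    have [aX|aX] := boolP (val a \in X); [left|right]; apply/eqP/setP=> b.
      by rewrite 3!inE conE aX; case: (_ \in X).
    by rewrite 2!inE conE (negPf aX) XY'; case: (_ \in X).
  case=> /eqP->; [exists x0|exists y0] => //; apply/setP=> b.
    by rewrite in_set in_setT conE; move: x0X; rewrite !inE => ->; case: (_ \in X).
  by rewrite in_set in_setT conE XY'; move: y0Y; rewrite XY' => /negPf->; case: (_ \in X).
split=> //; first by rewrite nm /= odd_double.
exists v; split=> //.
- rewrite /cut_vertex -/D compE cards2 XY'N ltnS; apply/card_le1_eqP=> C1 C2.
  case/imsetP=> a _ ->; case/imsetP=> b _ ->; apply/setP=> c.
  by rewrite !inE !conG.
- by rewrite -/D compE cards2 XY'N.
move=> C; rewrite -/D compE in_set2 => CXY; apply: complete_isomorphic.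
  rewrite card_sig nm /= doubleK.
  by case/orP: CXY => /eqP->; rewrite ?cX' ?cY'.
have clC (a b : {x | x \in [set~ v]}) : a \in C -> b \in C -> a != b ->
    G (val a) (val b).
  rewrite -(inj_eq val_inj) => aC bC ab.
  by case/orP: CXY aC bC => /eqP->; rewrite !inE => aC bC; [exact: clX|exact: clY].
move=> a b ab; apply: (clC (val a) (val b)); [exact: valP|exact: valP|].
by rewrite (inj_eq val_inj).
Qed.

(** * Types H2 and H3 recognized from a triangle and two cliques *)

Section Triangle.
Variables (v v' z x y : V) (X Y : {set V}) (m : nat).
Hypotheses (vv' : v != v') (vz : v != z) (v'z : v' != z).
Hypotheses (cX : #|X| = m) (cY : #|Y| = m) (nm : n = 3 + (m + m)).
Hypothesis notin : forall u, u \in [set v; v'; z] -> (u \notin X) && (u \notin Y).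
Hypothesis dXY : [disjoint X & Y].
Hypothesis clX : forall a b, a \in X -> b \in X -> a != b -> G a b.
Hypothesis clY : forall a b, a \in Y -> b \in Y -> a != b -> G a b.
Hypothesis nXY : forall a b, a \in X -> b \in Y -> ~~ G a b.
Hypotheses (xX : x \in X) (yY : y \in Y).
Hypotheses (Nv : N v = [set v'; z; x]) (Nv' : N v' = [set v; z; y]).

Let gX (i : 'I_m) : V := enum_val (cast_ord (esym cX) i).
Let gY (i : 'I_m) : V := enum_val (cast_ord (esym cY) i).

Let gXX i : gX i \in X. Proof. exact: enum_valP. Qed.
Let gYY i : gY i \in Y. Proof. exact: enum_valP. Qed.

Let gX_inj : injective gX.
Proof. by move=> i j /enum_val_inj/cast_ord_inj. Qed.
Let gY_inj : injective gY.
Proof. by move=> i j /enum_val_inj/cast_ord_inj. Qed.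

Let gX_onto u : u \in X -> exists i, gX i = u.
Proof.
move=> uX; exists (cast_ord cX (enum_rank_in uX u)).
by rewrite /gX cast_ord_comp cast_ord_id enum_rankK_in.
Qed.

Let gY_onto u : u \in Y -> exists i, gY i = u.
Proof.
move=> uY; exists (cast_ord cY (enum_rank_in uY u)).
by rewrite /gY cast_ord_comp cast_ord_id enum_rankK_in.
Qed.

Let g (p : H_vertex m) : V := match p with
  | inl i => tnth [tuple v; v'; z] i
  | inr (inl i) => gX i
  | inr (inr i) => gY i
  end.

Let neqX u i : u \in [set v; v'; z] -> (gX i == u) = false.
Proof.
by move/notin/andP=> [uX _]; apply: contraNF uX => /eqP <-; exact: gXX.
Qed.

Let neqY u i : u \in [set v; v'; z] -> (gY i == u) = false.
Proof.
by move/notin/andP=> [_ uY]; apply: contraNF uY => /eqP <-; exact: gYY.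
Qed.

Let neqXY i u : u \in Y -> (gX i == u) = false.
Proof.
by move=> uY; apply: contraTF uY => /eqP <-; rewrite (disjointFr dXY (gXX i)).
Qed.

Let neqYX i u : u \in X -> (gY i == u) = false.
Proof.
by move=> uX; apply: contraTF uX => /eqP <-; rewrite (disjointFl dXY (gYY i)).
Qed.

Let in3 : (v \in [set v; v'; z]) * (v' \in [set v; v'; z]) * (z \in [set v; v'; z]).
Proof. by rewrite !inE !eqxx !orbT. Qed.

Let gX_tnth i j : (gX i == tnth [tuple v; v'; z] j) = false.
Proof. by case: j => [[|[|[|//]]] lt3]; rewrite /tnth /= neqX ?in3. Qed.

Let gY_tnth i j : (gY i == tnth [tuple v; v'; z] j) = false.
Proof. by case: j => [[|[|[|//]]] lt3]; rewrite /tnth /= neqY ?in3. Qed.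

Let g_inj : injective g.
Proof.
have uniq3 : uniq [tuple v; v'; z] by rewrite /= !inE negb_or vv' vz v'z.
case=> [i|[i|i]] [j|[j|j]] //= /eqP.
- by rewrite !(tnth_nth v) nth_uniq ?size_tuple // => /eqP/val_inj->.
- by rewrite eq_sym gX_tnth.
- by rewrite eq_sym gY_tnth.
- by rewrite gX_tnth.
- by rewrite (inj_eq gX_inj) => /eqP->.
- by rewrite neqXY.
- by rewrite gY_tnth.
- by rewrite neqYX.
- by rewrite (inj_eq gY_inj) => /eqP->.
Qed.

(** The explicit map [g] goes from the model to [V]. It is injective between sets of equal size, and
    its inverse is the required isomorphism. *)
Let realize (K : sgraph (H_vertex m)) :
  (forall p q, K p q = G (g p) (g q)) -> isomorphic G K.
Proof.
move=> KE; have [|h gK hK] := inj_card_bij g_inj.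
  by rewrite cardV nm !card_sum !card_ord.
exists h; first by exists g.
by move=> a b; rewrite KE !hK.
Qed.

Let memN u w : G u w = (w \in N u). Proof. by rewrite inE. Qed.

Let edgeXX i j : G (gX i) (gX j) = (i != j).
Proof.
by have [->|ij] := eqVneq i j; [rewrite edge_irrefl|rewrite clX // (inj_eq gX_inj)].
Qed.

Let edgeYY i j : G (gY i) (gY j) = (i != j).
Proof.
by have [->|ij] := eqVneq i j; [rewrite edge_irrefl|rewrite clY // (inj_eq gY_inj)].
Qed.

Let edgeXY i j : G (gX i) (gY j) = false.
Proof. by apply/negbTE/nXY. Qed.

Let neqX3 i : ((gX i == v) = false) * ((gX i == v') = false) * ((gX i == z) = false).
Proof. by rewrite !neqX ?in3. Qed.

Let neqY3 i : ((gY i == v) = false) * ((gY i == v') = false) * ((gY i == z) = false).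
Proof. by rewrite !neqY ?in3. Qed.

Let edge_vX i u : gX u = x -> G v (gX i) = (i == u).
Proof. by move=> ux; rewrite memN Nv !inE !neqX3 // -ux (inj_eq gX_inj). Qed.

Let edge_vY i : G v (gY i) = false.
Proof. by rewrite memN Nv !inE !neqY3 // neqYX. Qed.

Let edge_v'X i : G v' (gX i) = false.
Proof. by rewrite memN Nv' !inE !neqX3 // neqXY. Qed.

Let edge_v'Y i u : gY u = y -> G v' (gY i) = (i == u).
Proof. by move=> uy; rewrite memN Nv' !inE !neqY3 // -uy (inj_eq gY_inj). Qed.

Let edge3 : (G v v' = true) * (G v z = true) * (G v' z = true).
Proof. by rewrite 2!memN Nv memN Nv' !inE !eqxx !orbT. Qed.

Let eq1 (i j : 'I_m) : (inG1 i == inG1 j) = (i == j).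
Proof. by []. Qed.

Let eq2 (i j : 'I_m) : (inG2 i == inG2 j) = (i == j).
Proof. by []. Qed.

Lemma type_H2_intro : N z = [set v; v'] -> type_H2 n G.
Proof.
move=> Nz; have mE : (n - 3)./2 = m by rewrite nm addKn addnn doubleK.
split; [by rewrite nm /= addnn odd_double|by []|].
rewrite mE; have [u1 u1x] := gX_onto xX; have [u2 u2y] := gY_onto yY.
exists u1, u2; apply: realize => p q.
have zX i : G z (gX i) = false by rewrite memN Nz !inE !neqX3.
have zY i : G z (gY i) = false by rewrite memN Nz !inE !neqY3.
have E := (edge_vX _ u1x, edge_vY, edge_v'X, edge_v'Y _ u2y, zX, zY, edge3,
  edgeXX, edgeYY, edgeXY).
case: p => [[[|[|[|//]]] ?]|[i|i]]; case: q => [[[|[|[|//]]] ?]|[j|j]];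
  rewrite /= /add_edge_rel /= /add_edge_rel /= /complete_rel ?andbF ?orbF /tnth /=
    ?edge_irrefl ?E ?eq1 ?eq2 //;
  by rewrite edge_sym E // andbC.
Qed.

Lemma type_H3_intro w : w \in Y -> N z = [set v; v'; w] -> type_H3 n G.
Proof.
move=> wY Nz; have mE : (n - 3)./2 = m by rewrite nm addKn addnn doubleK.
split; [by rewrite nm /= addnn odd_double|by []|].
rewrite mE; have [u1 u1x] := gX_onto xX; have [u2 u2y] := gY_onto yY.
have [u3 u3w] := gY_onto wY.
exists u1, u2, u3; apply: realize => p q.
have zX i : G z (gX i) = false by rewrite memN Nz !inE !neqX3 neqXY.
have zY i : G z (gY i) = (i == u3).
  by rewrite memN Nz !inE !neqY3 // -u3w (inj_eq gY_inj).
have E := (edge_vX _ u1x, edge_vY, edge_v'X, edge_v'Y _ u2y, zX, zY, edge3,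
  edgeXX, edgeYY, edgeXY).
case: p => [[[|[|[|//]]] ?]|[i|i]]; case: q => [[[|[|[|//]]] ?]|[j|j]];
  rewrite /= /add_edge_rel /= /add_edge_rel /= /add_edge_rel /= /complete_rel
    ?andbF ?orbF /tnth /= ?edge_irrefl ?E ?eq1 ?eq2 //;
  by rewrite edge_sym E // andbC.
Qed.

End Triangle.

End Realization.

(** * Low vertices and the components of their complement *)

Lemma card_setU_le (T : finType) (A B : {set T}) : #|A :|: B| <= #|A| + #|B|.
Proof. exact: leq_card_setU. Qed.

Lemma card_setU1_le (T : finType) (x : T) (A : {set T}) : #|x |: A| <= #|A| + 1.
Proof. by rewrite cardsU1 addnC leq_add2l leq_b1. Qed.

Section Sufficiency.
Variables (V : finType) (G : sgraph V) (n : nat).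
Hypotheses (conG : connected G) (cardV : #|V| = n) (n_ge : 270 <= n).

Notation N := (neighbors G).

Hypothesis NC : forall x y, x != y -> ~~ G x y -> n <= 2 * #|N x :|: N y| + 1.

Definition low : {set V} := [set v | 4 * degree G v + 1 < n].
Notation L := low.

Lemma lowP v : v \in L -> 4 * #|N v| + 1 < n.
Proof. by rewrite inE. Qed.

(** Two low vertices have fewer than (n - 1) / 2 neighbours together. *)
Lemma low_clique u v : u \in L -> v \in L -> u != v -> G u v.
Proof.
move=> /lowP uL /lowP vL uv; apply/idPn => /(NC uv).
by have := card_setU_le (N u) (N v); lia.
Qed.

Lemma high_degree l : l \notin L -> n <= 4 * #|N l| + 1.
Proof. by rewrite inE -leqNgt. Qed.

Lemma low_sub v : v \in L -> L \subset v |: N v.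
Proof.
move=> vL; apply/subsetP=> u uL; rewrite in_setU1 inE.
by have [//|uv] := eqVneq u v; apply: low_clique; rewrite // eq_sym.
Qed.

(** This is the hypothesis [link] of the growth argument, with [C] as the set dominated at the
    start. *)
Definition linked (C : {set V}) := forall A : {set V}, C \subset A ->
  A :|: L != setT ->
  exists l x, [/\ l \in A, l \notin L, x \notin A :|: L & G l x].

(** A low inner vertex [v] dominates the clique [L], so it suffices to dominate the high vertices.
    An unreached [x] is not adjacent to [v]; as [v] has low degree, [NC] forces the neighbours of
    [x] that [high_rest] demands. *)
Lemma linked_HIST S I v : hit G S I -> #|S| <= 3 * #|I| + 1 -> #|I| <= 2 ->
  v \in I -> v \in L \/ L = set0 -> linked (dominated G S I) -> has_HIST G.
Proof.
move=> hS cS cI vI vL lk.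
have LC : L \subset dominated G S I.
  case: vL => [/low_sub/subset_trans->//|->]; last exact: sub0set.
  apply/subsetP=> x; rewrite in_setU1 inE => /orP[/eqP->|].
    by apply: (subsetP (dominated_subl G S I)); apply: (subsetP (hit_sub hS)).
  exact: mem_dominated.
have rest_high x : x \notin L -> x \notin dominated G S I -> n <= 4 * #|N x :\: L| + 5.
  move=> xL xC; case: vL => [vL|L0]; last first.
    by have := high_degree xL; rewrite L0 setD0; lia.
  have vC u : u \in v |: N v -> u \in dominated G S I.
    rewrite in_setU1 inE => /orP[/eqP->|]; last exact: mem_dominated.
    by apply: (subsetP (dominated_subl G S I)); apply: (subsetP (hit_sub hS)).
  have xv : x != v by apply: contraNneq xC => ->; rewrite vC ?setU11.
  have nxv : ~~ G x v.
    by apply: contra xC => xv'; rewrite vC // in_setU1 inE edge_sym xv' orbT.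
  have := NC xv nxv; have := lowP vL.
  have : N x :|: N v \subset (N x :\: L) :|: N v.
    apply/subsetP=> z; rewrite !in_setU in_setD => /orP[zx|->]; last by rewrite orbT.
    rewrite zx andbT; have [zL|//] := boolP (z \in L).
    have := subsetP (low_sub vL) _ zL; rewrite in_setU1 => /orP[/eqP zv|-> //].
    by move: zx; rewrite zv inE (negPf nxv).
  move/subset_leq_card; have := card_setU_le (N x :\: L) (N v); lia.
have [S' [I' [hS' _ _ CC CL]]] :=
  hit_dominating cardV n_ge hS cS cI NC high_degree rest_high lk.
apply: hit_spanning hS' _; apply/eqP; rewrite -subTset -CL subUset subxx /=.
exact: subset_trans LC CC.
Qed.

Lemma star_hit v : 2 < degree G v -> exists S,
  [/\ hit G S [set v], #|S| <= 4 & v \in S].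
Proof.
move/card_gt2P=> [x [y [z [[xN yN zN] [xy yz zx]]]]].
exists [set v; x; y; z]; split; last by rewrite !inE eqxx.
  rewrite !inE in xN yN zN; apply: hit_star => //.
  by rewrite /= !inE negb_or xy yz eq_sym zx.
have -> : [set v; x; y; z] = z |: (y |: (x |: [set v])).
  by rewrite [x |: _]setUC [y |: _]setUC [z |: _]setUC.
by apply: leq_trans (card_setU1_le _ _) _; rewrite cardsU1 cards2; lia.
Qed.

Lemma star_HIST v : 2 < degree G v -> v \in L \/ L = set0 ->
  (forall C : {set V}, v |: N v \subset C -> linked C) -> has_HIST G.
Proof.
move=> dv vL lk; have [S [hS cS vS]] := star_hit dv.
apply: (linked_HIST hS _ _ (set11 v) vL); rewrite ?cards1 //.
apply: lk; apply/subsetP=> x; rewrite in_setU1 inE => /orP[/eqP->|vx].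
  exact: (subsetP (dominated_subl G _ _)).
by apply: mem_dominated vx; rewrite set11.
Qed.

(** These are the nonempty unions of components of [G - L]. *)
Definition separated (X : {set V}) := [&& X != set0, X \subset ~: L &
  [forall x in X, forall y, G x y ==> (y \in X :|: L)]].

Lemma separated_notin X x : separated X -> x \in X -> x \notin L.
Proof. by case/and3P=> _ /subsetP XL _ /XL; rewrite inE. Qed.

Lemma separated_edge X x y : separated X -> x \in X -> G x y -> y \in X :|: L.
Proof. by case/and3P=> _ _ /forall_inP/(_ x) H /H/forallP/(_ y)/implyP. Qed.

(** Without an edge between a high vertex of [A] and a high vertex outside it, [A] splits [G - L]
    along components, so closure under adjacency inside [A :\: L] is closure in [G - L]. *)
Lemma not_linked (A : {set V}) : A :|: L != setT ->
  (exists l x, [/\ l \in A, l \notin L, x \notin A :|: L & G l x]) \/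
  separated (~: (A :|: L)) /\
  forall X, X != set0 -> X \subset A :\: L ->
    (forall x y, x \in X -> G x y -> y \in A :\: L -> y \in X) -> separated X.
Proof.
move=> AL; have [/existsP[l /existsP[x /and4P[]]]|noE] :=
  boolP [exists l, exists x, [&& l \in A, l \notin L, x \notin A :|: L & G l x]].
  by left; exists l, x.
have noE' l x : l \in A -> l \notin L -> G l x -> x \in A :|: L.
  move=> lA lL lx; apply/negPn/negP=> xA; case/negP: noE.
  by apply/existsP; exists l; apply/existsP; exists x; rewrite lA lL xA.
right; split=> [|X X0 XA Xcl]; apply/and3P; split=> //.
- by apply: contraNneq AL => E; rewrite -[_ :|: _]setCK E setC0.
- by rewrite setCS subsetUr.
- apply/forall_inP=> x; rewrite in_setC => xA; apply/forallP=> y; apply/implyP=> xy.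
  rewrite in_setU in_setC; have [//|yL] := boolP (y \in L); first by rewrite orbT.
  rewrite orbF; apply: contra xA; rewrite in_setU (negPf yL) orbF => yA.
  by apply: noE' yA yL _; rewrite edge_sym.
- by apply: subset_trans XA _; rewrite setDE subsetIr.
- apply/forall_inP=> x xX; apply/forallP=> y; apply/implyP=> xy.
  rewrite in_setU; have [//|yL] := boolP (y \in L); first by rewrite orbT.
  rewrite orbF; have := subsetP XA _ xX; rewrite in_setD => /andP[xL xA].
  apply: (Xcl x) => //; have := noE' _ _ xA xL xy.
  by rewrite in_setU in_setD (negPf yL) orbF.
Qed.

(** * The case where [G - L] is connected *)

Section Connected.
Hypothesis connected_high : forall X, separated X -> X = ~: L.

Lemma linked_high (C : {set V}) w : w \in C -> w \notin L -> linked C.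
Proof.
move=> wC wL A CA AL; have [//|[sepA sep]] := not_linked AL.
have /setP/(_ w) : A :\: L = ~: L.
  apply: connected_high; apply: sep => //.
  by apply/set0Pn; exists w; rewrite in_setD wL (subsetP CA).
have := connected_high sepA => E _.
have : w \in ~: (A :|: L) by rewrite E in_setC.
by rewrite in_setC in_setU (subsetP CA).
Qed.

(** If [L] is empty, or a low vertex with a high neighbour has degree at least 3, a star there
    starts the growth. Otherwise the growth starts at a high neighbour [w] of a low [v] of degree at
    most 2. It can miss only one low vertex [v'], with [N v] equal to [[set v'; w]]; a high
    neighbour of [v'] can be promoted to reach it, and if there is none, [v'] is pendant at [v]. *)
Lemma connected_high_HIST : ~ pendant_adjacent_to_degree_2 G -> has_HIST G.
Proof.
move=> no_pend.
have [w0 w0L] : exists w, w \notin L.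
  have [v _] : exists v : V, v \in V by apply/card_gt0P; rewrite cardV; lia.
  have [LT|] := eqVneq L setT; last first.
    by rewrite -subTset => /subsetPn[w _ wL]; exists w.
  have := lowP (_ : v \in L); rewrite LT inE => /(_ isT).
  have -> : N v = [set~ v].
    apply/setP=> x; rewrite !inE; apply/idP/idP; first by rewrite eq_sym => /edge_neq.
    by rewrite eq_sym => vx; apply: low_clique; rewrite ?LT.
  by have := cardsC1 v; rewrite cardV; lia.
have [L0|/set0Pn[v0 v0L]] := eqVneq L set0.
  apply: (@star_HIST w0); last 2 first.
  - by right.
  - by move=> C CC; apply: linked_high w0L; apply: (subsetP CC); rewrite setU11.
  by have := high_degree w0L; rewrite /degree; lia.
have [/existsP[v /existsP[w /and4P[vL wL vw dv]]]|nod] :=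
    boolP [exists v, exists w, [&& v \in L, w \notin L, G v w & 2 < degree G v]].
  apply: (star_HIST dv); first by left.
  move=> C CC; apply: linked_high wL; apply: (subsetP CC).
  by rewrite in_setU1 inE vw orbT.
have [v [w [vL wL vw]]] := connected_cut conG v0L w0L.
have Nv u : G v u -> u != w -> N v = [set u; w].
  move=> vu uw; apply/esym/eqP; rewrite eqEcard subUset !sub1set !inE vu vw cards2 uw.
  by move/existsPn/(_ v)/existsPn/(_ w): nod; rewrite vL wL vw -leqNgt.
have dw : 2 < degree G w by have := high_degree wL; rewrite /degree; lia.
have [S [hS cS wS]] := star_hit dw.
have NwC x : G w x -> x \in dominated G S [set w] by apply: mem_dominated; rewrite set11.
have wC : w \in dominated G S [set w] by exact: (subsetP (dominated_subl G _ _)).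
(* At most one neighbour of [v] differs from [w], so [L] has at most one vertex besides [v], and
   none if [v] is adjacent to [x]. Hence [x] has at most one low neighbour. *)
have rest_high x : x \notin L -> x \notin dominated G S [set w] -> n <= 4 * #|N x :\: L| + 5.
  move=> xL xC; have := high_degree xL; rewrite -(cardsID L (N x)).
  suff : #|N x :&: L| <= 1 by clear; lia.
  have xw : x != w by apply: contraNneq xC => ->.
  have L1 u : u \in L -> u != v -> G v u.
    by move=> uL uv; apply: low_clique; rewrite // eq_sym.
  have Lw u : u \in L -> u != w by move=> uL; apply: contraNneq wL => <-.
  have [vx|nvx] := boolP (G v x).
    apply: leq_trans (subset_leq_card (subsetIr _ _)) _.
    rewrite -(cards1 v); apply/subset_leq_card/subsetP=> u uL; rewrite inE.
    apply: contraT => uv; have := Nv u (L1 u uL uv) (Lw u uL).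
    move/setP/(_ x); rewrite !inE vx (negPf xw) orbF => /esym/eqP xu.
    by rewrite xu uL in xL.
  apply/card_le1_eqP=> u u'; rewrite !in_setI ![_ \in N x]inE => /andP[xu uL] /andP[xu' u'L].
  have uv : u != v by apply: contraNneq nvx => <-; rewrite edge_sym.
  have u'v : u' != v by apply: contraNneq nvx => <-; rewrite edge_sym.
  have := Nv u (L1 u uL uv) (Lw u uL); move/setP/(_ u'); rewrite !inE L1 //.
  by rewrite (negPf (Lw _ u'L)) orbF => /esym/eqP.
have [||S' [I' [hS' cS' cI' CC CL]]] :=
  hit_dominating cardV n_ge hS _ _ NC high_degree rest_high (linked_high wC wL).
- by rewrite cards1.
- by rewrite cards1.
have LC : L :\ v \subset dominated G S' I' -> has_HIST G.
  move=> LvC; apply: hit_spanning hS' _; apply/eqP; rewrite -subTset -CL subUset subxx /=.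
  apply/subsetP=> u uL; have [->|uv] := eqVneq u v.
    by apply: (subsetP CC); rewrite NwC // edge_sym.
  by apply: (subsetP LvC); rewrite in_setD1 uv.
have [/LC//|/subsetPn[v' ]] := boolP (L :\ v \subset dominated G S' I').
rewrite in_setD1 => /andP[v'v v'L] v'C.
have vv' : G v v' by apply: low_clique; rewrite // eq_sym.
have v'w : v' != w by apply: contraNneq wL => <-.
have {}Nv := Nv v' vv' v'w.
have [/existsP[w' /andP[w'L v'w']]|noN] := boolP [exists w', (w' \notin L) && G v' w'].
  have w'C : w' \in dominated G S' I'.
    by have := in_setT w'; rewrite -CL in_setU (negPf w'L) orbF.
  have w'I : w' \notin I'.
    by apply: contra v'C => w'I; apply: mem_dominated w'I _; rewrite edge_sym.
  have w'w : w' != w.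
    apply: contraNneq v'C => w'w; apply: (subsetP CC); apply: NwC.
    by rewrite -w'w edge_sym.
  have nw'v : ~~ G w' v.
    rewrite edge_sym; apply/negP=> vw'; have : w' \in N v by rewrite inE.
    by rewrite Nv !inE (negPf w'w) orbF => /eqP w'v'; rewrite w'v' edge_irrefl in v'w'.
  have w'v : w' != v by apply: contraNneq w'L => ->.
  (* As [w'] is not adjacent to [v], which has degree 2, it has at least (n - 5) / 2 neighbours,
     while |S'| is at most 3 (n - 5) / 8 + 1. *)
  have [|S2 [hS2 _ _ C2]] := promote hS' w'C w'I.
    have := NC w'v nw'v; have := card_setU_le (N w') (N v).
    have := cardsID S' (N w'); have := subset_leq_card (subsetIr (N w') S').
    rewrite Nv cards2 v'w; move: #|N w'| #|N w' :&: S'| #|N w' :\: S'| #|_ :|: _|.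
    by clear - n_ge cS' cI'; lia.
  apply: hit_spanning hS2 _; apply/eqP; rewrite -subTset -CL subUset.
  have C'2 : dominated G S' I' \subset dominated G S2 (w' |: I').
    by apply: subset_trans C2; exact: subsetUl.
  rewrite C'2 /=; apply/subsetP=> u uL; have [->|uv] := eqVneq u v.
    by apply: (subsetP C'2); apply: (subsetP CC); rewrite NwC // edge_sym.
  have /set2P[uE|uE] : u \in [set v'; w].
  - by rewrite -Nv inE; apply: low_clique; rewrite // eq_sym.
  - by apply: (subsetP C2); rewrite in_setU !inE uE edge_sym v'w' orbT.
  by rewrite uE (negPf wL) in uL.
case: no_pend; exists v', v; split; last by rewrite edge_sym.
  apply/eqP/cards1P; exists v; apply/setP=> u; rewrite !inE.
  have [->|uv] := eqVneq u v; first by rewrite edge_sym.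
  apply/negP=> v'u; move/existsPn/(_ u): noN; rewrite v'u andbT negbK => uL.
  have : u \in N v by rewrite inE; apply: low_clique; rewrite // eq_sym.
  rewrite Nv !inE => /orP[]/eqP uE; first by rewrite uE edge_irrefl in v'u.
  by rewrite uE (negPf wL) in uL.
by rewrite /degree Nv cards2 v'w.
Qed.

End Connected.

(** * The case where [G - L] is disconnected *)

(** Some [a] in [X] is not adjacent to [v], since otherwise the low vertex [v] would have at least
    the degree of a vertex of [X]. Apply [NC] to [a] and [v]: both are missing from the union of
    their neighbourhoods, which accounts for the 3. *)
Lemma separated_card X v : separated X -> v \in L ->
  n + 3 <= 2 * (#|X| + #|L| + #|N v :\: (X :|: L)|).
Proof.
move=> sX vL; have XL x : x \in X -> x \notin L by exact: separated_notin.
have cL : #|L| = #|L :\ v|.+1 by rewrite (cardsD1 v) vL.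
have Na a : a \in X -> N a \subset (X :\ a) :|: L.
  move=> aX; apply/subsetP=> z; rewrite inE => az.
  have := separated_edge sX aX az; rewrite !in_setU in_setD1.
  by rewrite (_ : z != a) // eq_sym (edge_neq az).
have [a aX nav] : exists2 a, a \in X & ~~ G a v.
  have [XN|/subsetPn[a aX avN]] := boolP (X \subset N v); last first.
    by exists a => //; move: avN; rewrite inE edge_sym.
  have /set0Pn[a aX] : X != set0 by case/and3P: sX.
  have := high_degree (XL _ aX); have := lowP vL.
  have := leq_trans (subset_leq_card (Na _ aX)) (card_setU_le _ _).
  have : X :|: (L :\ v) \subset N v.
    rewrite subUset XN; apply/subsetP=> u; rewrite in_setD1 => /andP[uv uL].
    by have := subsetP (low_sub vL) _ uL; rewrite in_setU1 (negPf uv).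
  move/subset_leq_card; have := cardsD1 a X; rewrite aX.
  have := cardsUI X (L :\ v).
  have -> : X :&: (L :\ v) = set0.
    apply/setP=> z; rewrite in_setI in_setD1 in_set0; have [/XL/negPf->|//] := boolP (z \in X).
    by rewrite andbF.
  by rewrite cards0 cL; clear; lia.
have av : a != v by apply: contraTneq vL => <-; exact: XL.
have := NC av nav.
have : N a :|: N v \subset (X :\ a) :|: (L :\ v) :|: (N v :\: (X :|: L)).
  apply/subsetP=> z zN; have za : z != a.
    apply: contraTneq zN => ->.
    by rewrite in_setU !inE edge_irrefl edge_sym.
  have zv : z != v by apply: contraTneq zN => ->; rewrite in_setU !inE edge_irrefl orbF.
  rewrite in_setU [z \in _ :|: (L :\ v)]in_setU !in_setD1 za zv /=.
  rewrite in_setD [z \in X :|: L]in_setU.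
  have [//|nXL] := boolP ((z \in X) || (z \in L)).
  move: zN; rewrite in_setU => /orP[/(subsetP (Na _ aX))|-> //].
  by rewrite in_setU in_setD1 za (negPf nXL).
move/subset_leq_card => H; have := leq_trans H (card_setU_le _ _).
have := card_setU_le (X :\ a) (L :\ v); have := cardsD1 a X.
by rewrite aX cL; clear; lia.
Qed.

(** Add the three bounds of [separated_card]. Each high neighbour of [v] is counted in two of them,
    so n + 5 <= 4 |N v|, although [v] is low. *)
Lemma separated_three X Y Z : separated X -> separated Y -> separated Z ->
  [disjoint X & Y] -> [disjoint X :|: Y & Z] -> X :|: Y :|: Z = ~: L ->
  L != set0 -> False.
Proof.
move=> sX sY sZ dXY dXYZ E /set0Pn[v vL].
have := separated_card sX vL; have := separated_card sY vL.
have := separated_card sZ vL; have := lowP vL.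
have cE : #|X| + #|Y| + #|Z| + #|L| = n.
  by rewrite -cardV -(cardsC L) -E !cardsU; move: dXY dXYZ;
     rewrite -!setI_eq0 => /eqP-> /eqP->; rewrite !cards0; lia.
have cN : #|N v :\: L| + #|L| = #|N v| + 1.
  rewrite -(cardsID L (N v)) (cardsD1 v L) vL.
  have -> : N v :&: L = L :\ v.
    apply/setP=> u; rewrite in_setI in_setD1 inE andbC; have [uL|] := boolP (u \in L); last by rewrite andbF.
    rewrite andbT /=; apply/idP/idP; first by rewrite eq_sym => /edge_neq.
    by rewrite eq_sym => uv; apply: low_clique.
  by clear; lia.
have sub W : #|N v :\: (W :|: L)| + #|(N v :\: L) :&: W| = #|N v :\: L|.
  by rewrite -(cardsID W (N v :\: L)) setDDl [L :|: W]setUC addnC.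
have := sub X; have := sub Y; have := sub Z.
have : #|N v :\: L| <= #|(N v :\: L) :&: X| + #|(N v :\: L) :&: Y| + #|(N v :\: L) :&: Z|.
  apply: leq_trans (_ : #|(N v :\: L) :&: X :|: (N v :\: L) :&: Y :|: (N v :\: L) :&: Z| <= _).
    apply: subset_leq_card; rewrite -!setIUr E; apply/subsetP=> z zN.
    by rewrite in_setI zN in_setC; move: zN; rewrite in_setD => /andP[].
  apply: leq_trans (card_setU_le _ _) _; rewrite leq_add2r.
  exact: card_setU_le.
by move: cE cN; clear; lia.
Qed.

Definition bisected X Y := [/\ separated X, separated Y, [disjoint X & Y] &
  X :|: Y = ~: L].

Lemma bisected_sym X Y : bisected X Y -> bisected Y X.
Proof. by case=> sX sY dXY E; split; rewrite // 1?disjoint_sym // setUC. Qed.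

Lemma bisected_card X Y : bisected X Y -> #|X| + #|Y| + #|L| = n.
Proof.
case=> _ _ dXY E; rewrite -cardV -(cardsC L) -E cardsU.
by move: dXY; rewrite -setI_eq0 => /eqP->; rewrite cards0; lia.
Qed.

Lemma bisected_notin X Y z : bisected X Y -> z \in X -> z \notin Y.
Proof. by case=> _ _ dXY _ zX; rewrite (disjointFr dXY zX). Qed.

Lemma bisected_in X Y z : bisected X Y -> z \notin L -> z \notin X -> z \in Y.
Proof.
case=> _ _ _ E zL /negPf zX; have : z \in X :|: Y by rewrite E in_setC.
by rewrite in_setU zX.
Qed.

Lemma bisected_edge X Y x y : bisected X Y -> x \in X -> y \in Y -> ~~ G x y.
Proof.
move=> sXY xX yY; apply/negP=> xy; case: (sXY) => sX sY _ _.
have := separated_edge sX xX xy; rewrite in_setU.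
by rewrite (negPf (separated_notin sY yY)) (negPf (bisected_notin (bisected_sym sXY) yY)).
Qed.

Lemma bisected_low X Y : bisected X Y -> L != set0.
Proof.
move=> sXY; apply/eqP=> L0; case: (sXY) => sX sY _ E.
have /set0Pn[x xX] : X != set0 by case/and3P: sX.
have /set0Pn[y yY] : Y != set0 by case/and3P: sY.
have [a [b [aX bX ab]]] := connected_cut conG xX (bisected_notin (bisected_sym sXY) yY).
by have := separated_edge sX aX ab; rewrite in_setU L0 in_set0 orbF (negPf bX).
Qed.

(** Otherwise [A :&: X], [A :&: Y] and the high vertices outside [A] would be three separated sets,
    against [separated_three]. *)
Lemma linked_bisected X Y (C : {set V}) x y : bisected X Y ->
  x \in X -> x \in C -> y \in Y -> y \in C -> linked C.
Proof.
move=> sXY xX xC yY yC A CA AL; have [//|[sepA sep]] := not_linked AL.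
case: (sXY) => sX sY dXY E; have sYX := bisected_sym sXY.
have part (Z Z' : {set V}) z : bisected Z Z' -> z \in Z -> z \in C -> separated (A :&: Z).
  move=> sZ zZ zC; have ZL u : u \in Z -> u \notin L.
    by case: sZ => sZ _ _ _; exact: separated_notin.
  apply: sep.
  - by apply/set0Pn; exists z; rewrite in_setI zZ (subsetP CA).
  - by apply/subsetP=> u; rewrite in_setI in_setD => /andP[-> /ZL->].
  move=> u w; rewrite !in_setI in_setD => /andP[uA uZ] uw /andP[wL ->] /=.
  case: sZ => sZ _ _ _; have := separated_edge sZ uZ uw.
  by rewrite in_setU (negPf wL) orbF.
exfalso; apply: (separated_three (part X Y x sXY xX xC) (part Y X y sYX yY yC) sepA).
- by apply: disjointWl (subsetIr _ _) _; apply: disjointWr (subsetIr _ _) _.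
- rewrite -setIUr E -setDE disjoints_subset setCK.
  by apply: subset_trans (subsetDl _ _) (subsetUl _ _).
- rewrite -setIUr E; apply/setP=> z; rewrite in_setU in_setI !in_setC in_setU.
  by case: (z \in A); case: (z \in L).
- exact: bisected_low sXY.
Qed.


(** The starting tree is the star at [v] with leaves [v'], [x], [e], where [v'] is then given the
    children [y] and [e']. It meets both [X] and [Y], so the growth is linked. *)
Lemma double_star_HIST X Y v v' x y e e' : bisected X Y ->
  v \in L -> v' \in L -> v != v' -> x \in X -> y \in Y -> G v x -> G v' y ->
  (forall u, u \in X -> ~~ G v' u) -> (forall u, u \in Y -> ~~ G v u) ->
  G v e -> G v' e' -> e != v' -> e != x -> e' != v -> e' != y -> e != e' ->
  has_HIST G.
Proof.
move=> sXY vL v'L vv' xX yY vx v'y nX nY ve v'e' ev' ex e'v e'y ee'.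
have [XL YL] : (forall u, u \in X -> u \notin L) /\ (forall u, u \in Y -> u \notin L).
  by case: sXY => sX sY _ _; split=> u; exact: separated_notin.
have Gvv' : G v v' by exact: low_clique.
have hS1 : hit G [set v; v'; x; e] [set v].
  apply: hit_star => //; rewrite /= !inE negb_or ![v' == _]eq_sym ev' ![x == _]eq_sym ex !andbT.
  by apply: contraTneq v'L => ->; exact: XL.
have NyS : y \notin [set v; v'; x; e].
  rewrite !inE !negb_or -!andbA; apply/and4P; split.
  - by apply: contraTneq vL => <-; exact: YL.
  - by apply: contraTneq v'L => <-; exact: YL.
  - by apply: contraTneq xX => <-; exact: bisected_notin (bisected_sym sXY) yY.
  - by apply: contraTneq ve => <-; exact: nY.
have Ne'S : e' \notin [set v; v'; x; e].
  rewrite !inE !negb_or -!andbA e'v [e' == e]eq_sym ee' andbT /=; apply/andP; split.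
    by rewrite eq_sym (edge_neq v'e').
  by apply: contraTneq v'e' => ->; exact: nX.
have hS : hit G (y |: (e' |: [set v; v'; x; e])) [set v'; v].
  by apply: (hit_grow hS1 _ _ NyS Ne'S _ v'y v'e'); rewrite ?inE ?eqxx ?orbT // eq_sym.
apply: (linked_HIST hS _ _ (set22 _ _)); last 2 first.
- by left.
- apply: (linked_bisected sXY xX _ yY).
    by apply: mem_dominated vx; rewrite set22.
  by apply: mem_dominated v'y; rewrite set21.
- have -> : [set v; v'; x; e] = e |: (x |: (v' |: [set v])).
    by rewrite [v' |: _]setUC [x |: _]setUC [e |: _]setUC.
  rewrite cards2 eq_sym vv'.
  have U1 u (B : {set V}) k : #|B| <= k -> #|u |: B| <= k.+1.
    by move=> Bk; rewrite (leq_trans (card_setU1_le u B)) // addn1.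
  by rewrite -[_ + 1]/7; do 5!apply: (U1); rewrite cards1.
- by rewrite cards2; case: (_ != _).
Qed.

(** The common neighbour [z] can serve as [e] or [e'] of the double star. A further neighbour of [v]
    or [v'] supplies the other leaf, so only the two exact neighbourhoods remain. *)
Lemma low_triple X Y v v' x y z : bisected X Y ->
  v \in L -> v' \in L -> v != v' -> x \in X -> y \in Y -> G v x -> G v' y ->
  (forall u, u \in X -> ~~ G v' u) -> (forall u, u \in Y -> ~~ G v u) ->
  z \in L -> z != v -> z != v' ->
  has_HIST G \/ N v = [set v'; z; x] /\ N v' = [set v; z; y].
Proof.
move=> sXY vL v'L vv' xX yY vx v'y nX nY zL zv zv'.
have [XL YL] : (forall u, u \in X -> u \notin L) /\ (forall u, u \in Y -> u \notin L).
  by case: sXY => sX sY _ _; split=> u; exact: separated_notin.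
have Gvv' : G v v' by exact: low_clique.
have Gvz : G v z by apply: low_clique; rewrite // eq_sym.
have Gv'z : G v' z by apply: low_clique; rewrite // eq_sym.
have zx : z != x by apply: contraTneq zL => ->; exact: XL.
have zy : z != y by apply: contraTneq zL => ->; exact: YL.
have DS := double_star_HIST sXY vL v'L vv' xX yY vx v'y nX nY.
have [Nv|] := boolP (N v \subset [set v'; z; x]); last first.
  case/subsetPn=> e; rewrite !inE !negb_or => ve /andP[/andP[ev' ez] ex].
  by left; apply: (DS e z).
have [Nv'|] := boolP (N v' \subset [set v; z; y]); last first.
  case/subsetPn=> e; rewrite !inE !negb_or => ve /andP[/andP[ev' ez] ex].
  by left; apply: (DS z e) => //; rewrite eq_sym.
right; split; apply/eqP; rewrite eqEsubset ?Nv ?Nv' !subUset !sub1set !inE.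
  by rewrite Gvv' Gvz vx.
by rewrite edge_sym Gvv' Gv'z v'y.
Qed.

(** The set [B] contains all low neighbours of [X]. Nonadjacent [a] and [b] would have all their
    neighbours in [B] and in [X] without [a] and [b], too few for [NC]. *)
Lemma bisected_clique X Y (B : {set V}) a b : bisected X Y -> a \in X -> b \in X -> a != b ->
  B \subset L -> (forall u w, u \in X -> w \in L -> G u w -> w \in B) ->
  2 * (#|X| + #|B|) < n + 3 -> G a b.
Proof.
move=> sXY aX bX ab BL XB XBn; apply/idPn=> nab; have := NC ab nab.
have : N a :|: N b \subset (X :\ a :\ b) :|: B.
  have NX c z : c \in X -> G c z -> (z \in X) || (z \in B).
    move=> cX cz; case: (sXY) => sX _ _ _; have := separated_edge sX cX cz.
    by rewrite in_setU => /orP[->//|zL]; rewrite (XB c z) ?orbT.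
  have NL c : c \in X -> c \notin L by case: (sXY) => sX _ _ _; exact: separated_notin.
  apply/subsetP=> z; rewrite in_setU [_ \in N a]inE [_ \in N b]inE => zab.
  rewrite in_setU !in_setD1.
  have -> : z != a by apply: contraTneq zab => ->; rewrite edge_irrefl edge_sym.
  have -> : z != b by apply: contraTneq zab => ->; rewrite edge_irrefl (negPf nab).
  by case/orP: zab => /NX->.
move/subset_leq_card => H; have := leq_trans H (card_setU_le _ _).
have := cardsD1 a X; have := cardsD1 b (X :\ a).
rewrite in_setD1 eq_sym ab aX bX; move: XBn; clear; lia.
Qed.

Lemma bisected_complement (X : {set V}) : separated X -> X != ~: L ->
  bisected X (~: (X :|: L)).
Proof.
move=> sX XL; have XsL : X \subset ~: L by case/and3P: sX.
split=> //.
- apply/and3P; split.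
  + apply: contraNneq XL => E; rewrite eqEsubset XsL /=; apply/subsetP=> z.
    rewrite in_setC => zL; have : z \notin ~: (X :|: L) by rewrite E in_set0.
    by rewrite in_setC negbK in_setU (negPf zL) orbF.
  + by rewrite setCS subsetUr.
  + apply/forall_inP=> y; rewrite in_setC => yXL; apply/forallP=> w; apply/implyP=> yw.
    rewrite in_setU in_setC -implyNb; apply/implyP; rewrite negbK in_setU.
    case/orP=> [wX|//]; case/negP: yXL; apply: (separated_edge sX wX).
    by rewrite edge_sym.
- by rewrite -setI_eq0; apply/eqP/setP=> z; rewrite in_setI in_setC in_setU in_set0; case: (z \in X).
apply/setP=> z; rewrite in_setU !in_setC in_setU.
have [/(subsetP XsL)|_ //] := boolP (z \in X); first by rewrite in_setC => ->.
Qed.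

(** Both neighbours of [v] are high, so [L] is [[set v]]. Then [separated_card] gives each side at
    least (n - 1) / 2 vertices, hence exactly that many, and [bisected_clique] applies. *)
Lemma bisected_H1 X Y v x y : bisected X Y -> v \in L -> x \in X -> y \in Y ->
  G v x -> G v y -> degree G v = 2 -> type_H1 n G.
Proof.
move=> sXY vL xX yY vx vy dv; case: (sXY) => sX sY dXY XYL; have sYX := bisected_sym sXY.
have xy : x != y by apply: contraTneq yY => <-; exact: bisected_notin sXY xX.
have Nv : N v = [set x; y].
  by apply/esym/eqP; rewrite eqEcard subUset !sub1set !inE vx vy cards2 xy -dv leqnn.
have Lv : L = [set v].
  apply/eqP; rewrite eqEsubset sub1set vL andbT; apply/subsetP=> u uL.
  have := subsetP (low_sub vL) _ uL; rewrite in_set1 in_setU1 => /orP[//|].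
  by rewrite Nv => /set2P[] uE; move: uL; rewrite uE;
     rewrite ?(negPf (separated_notin sX xX)) ?(negPf (separated_notin sY yY)).
have Nx1 : #|N v :\: (X :|: L)| <= 1.
  rewrite -(cards1 y); apply/subset_leq_card/subsetP=> u.
  rewrite Nv in_setD in_setU negb_or in_set1 => /andP[/andP[uX _] /set2P[]uE].
    by rewrite uE xX in uX.
  by rewrite uE.
have Ny1 : #|N v :\: (Y :|: L)| <= 1.
  rewrite -(cards1 x); apply/subset_leq_card/subsetP=> u.
  rewrite Nv in_setD in_setU negb_or in_set1 => /andP[/andP[uY _] /set2P[]uE].
    by rewrite uE.
  by rewrite uE yY in uY.
have c1 := separated_card sX vL; have c2 := separated_card sY vL.
have := bisected_card sXY; rewrite Lv cards1 => cXY.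
rewrite Lv cards1 in c1 c2; rewrite Lv in Nx1 Ny1.
have [m [cX cY nm m0]] : exists m, [/\ #|X| = m, #|Y| = m, n = m.*2.+1 & 0 < m].
  exists #|X|; move: Nx1 Ny1 c1 c2 cXY n_ge; clear=> *; split; lia.
have clique Z Z' : bisected Z Z' -> #|Z| = m -> forall a b, a \in Z -> b \in Z -> a != b -> G a b.
  move=> sZ cZ a b aZ bZ ab; apply: (@bisected_clique Z Z' [set v]) => //.
  - by rewrite Lv.
  - by move=> u w _; rewrite Lv.
  - by rewrite cards1 cZ nm; clear; lia.
apply: (@type_H1_intro _ _ _ conG cardV _ v X Y m) => //.
- by rewrite (leq_trans _ n_ge).
- by rewrite XYL Lv.
- exact: clique sXY cX.
- exact: clique sYX cY.
- by move=> a b; exact: bisected_edge.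
Qed.

(** A low vertex touching both sides yields a star or type H1. Otherwise [v] touches only [X] and
    [v'] only [Y]; counting provides a third low vertex [z], and without a double star [L] is the
    triangle [v], [v'], [z]. The high neighbours of [z] decide between H2 and H3. *)
Lemma bisected_dichotomy X Y : bisected X Y ->
  has_HIST G \/ [\/ type_H1 n G, type_H2 n G | type_H3 n G].
Proof.
move=> sXY; case: (sXY) => sX sY dXY XYL; have sYX := bisected_sym sXY.
have [XL YL] : (forall u, u \in X -> u \notin L) /\ (forall u, u \in Y -> u \notin L).
  by split=> u; exact: separated_notin.
have [/existsP[v /existsP[x /existsP[y /and5P[vL xX yY vx vy]]]]|noV] :=
  boolP [exists v, exists x, exists y, [&& v \in L, x \in X, y \in Y, G v x & G v y]].
  have [dv|dv] := ltnP 2 (degree G v).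
    left; apply: (star_HIST dv); first by left.
    move=> C NC'; apply: (linked_bisected sXY xX _ yY); apply: (subsetP NC').
      by rewrite in_setU1 inE vx orbT.
    by rewrite in_setU1 inE vy orbT.
  right; constructor 1; apply: (bisected_H1 sXY vL xX yY vx vy).
  apply/eqP; rewrite eqn_leq dv; apply: leq_trans (_ : #|[set x; y]| <= _).
    by rewrite cards2 (_ : x != y) //; apply: contraTneq yY => <-; exact: bisected_notin sXY xX.
  by apply/subset_leq_card; rewrite subUset !sub1set !inE vx vy.
have one v x y : v \in L -> x \in X -> y \in Y -> G v x -> ~~ G v y.
  move=> vL xX yY vx; apply/negP=> vy; case/negP: noV.
  by apply/existsP; exists v; apply/existsP; exists x; apply/existsP; exists y; apply/and5P.
have touch Z Z' : bisected Z Z' -> exists z v, [/\ z \in Z, v \in L & G v z].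
  move=> sZ; case: (sZ) => sZ1 sZ2 _ _.
  have /set0Pn[a aZ] : Z != set0 by case/and3P: sZ1.
  have /set0Pn[b bZ] : Z' != set0 by case/and3P: sZ2.
  have [z [v [zZ vZ zv]]] := connected_cut conG aZ (bisected_notin (bisected_sym sZ) bZ).
  exists z, v; split=> //; last by rewrite edge_sym.
  by have := separated_edge sZ1 zZ zv; rewrite in_setU (negPf vZ).
have [x [v [xX vL vx]]] := touch X Y sXY.
have [y [v' [yY v'L v'y]]] := touch Y X sYX.
have nY u : u \in Y -> ~~ G v u by move=> uY; apply: (one v x).
have nX u : u \in X -> ~~ G v' u.
  by move=> uX; apply/negP=> /(one v' u y v'L uX yY); rewrite v'y.
have vv' : v != v' by apply: contraTneq v'y => <-; exact: nY.
have outside w (Z Z' : {set V}) : bisected Z Z' -> (forall u, u \in Z' -> ~~ G w u) ->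
    N w :\: (Z :|: L) = set0.
  move=> sZ nZ; apply/setP=> u.
  rewrite in_setD in_setU [u \in N w]inE in_set0 negb_or.
  apply/negP=> /andP[/andP[uZ uL] wu].
  by have := nZ u (bisected_in sZ uL uZ); rewrite wu.
have cX := separated_card sX vL; rewrite (outside _ _ _ sXY nY) cards0 addn0 in cX.
have cY := separated_card sY v'L; rewrite (outside _ _ _ sYX nX) cards0 addn0 in cY.
have cXYL := bisected_card sXY.
(* Adding [cX] and [cY] and using [cXYL] gives 2 (n + |L|) >= 2n + 6. *)
have L3 : 2 < #|L| by move: cX cY cXYL; clear; lia.
have [z zL /andP[zv zv']] : exists2 z, z \in L & (z != v) && (z != v').
  have /set0Pn[z] : L :\: [set v; v'] != set0.
    rewrite -card_gt0; have := cardsID [set v; v'] L.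
    have := subset_leq_card (subsetIr L [set v; v']); rewrite cards2 vv'.
    by move: L3; clear; lia.
  by rewrite in_setD in_set2 negb_or => /andP[zz zL]; exists z.
have [|[Nv Nv']] := low_triple sXY vL v'L vv' xX yY vx v'y nX nY zL zv zv'.
  by left.
have LE : L = [set v; v'; z].
  apply/eqP; rewrite eqEsubset !subUset !sub1set vL v'L zL !andbT.
  apply/subsetP=> u uL; have := subsetP (low_sub vL) _ uL.
  rewrite Nv in_setU1 !in_setU !in_set1 -!orbA => /or4P[->|->|->|/eqP ux]; rewrite ?orbT //.
  by move: uL; rewrite ux (negPf (XL _ xX)).
have cL : #|L| = 3.
  by rewrite LE -setUA cardsU1 cards2 !inE negb_or vv' ![_ == z]eq_sym zv zv'.
rewrite cL in cX cY cXYL.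
have [m [cXm cYm nm]] : exists m, [/\ #|X| = m, #|Y| = m & n = 3 + (m + m)].
  by exists #|X|; move: cX cY cXYL; clear=> *; split; lia.
(* The low vertex [w] has no neighbour in [Z], so [B] may be taken as the other two low vertices,
   and 2 (m + 2) < n + 3 = 2m + 6. *)
have clique Z Z' w : bisected Z Z' -> w \in L -> (forall u, u \in Z -> ~~ G w u) ->
    #|Z| = m -> forall a b, a \in Z -> b \in Z -> a != b -> G a b.
  move=> sZ wL nw cZ a b aZ bZ ab.
  apply: (@bisected_clique Z Z' (L :\ w)) => //.
  - exact: subsetDl.
  - move=> u t uZ tL ut; rewrite in_setD1 tL andbT.
    by apply: contraTneq ut => ->; rewrite edge_sym nw.
  - by have := cardsD1 w L; rewrite wL cL cZ nm; clear; lia.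
have clX := clique X Y v' sXY v'L nX cXm.
have clY := clique Y X v sYX vL nY cYm.
have nin u : u \in [set v; v'; z] -> (u \notin X) && (u \notin Y).
  rewrite -LE => uL; apply/andP; split; apply: contraTN uL; [exact: XL|exact: YL].
have nE a b : a \in X -> b \in Y -> ~~ G a b by exact: bisected_edge.
have nE' a b : a \in Y -> b \in X -> ~~ G a b by exact: bisected_edge.
have n5 : 5 <= n by rewrite (leq_trans _ n_ge).
have [vz v'z] : v != z /\ v' != z by rewrite ![_ == z]eq_sym.
have [/existsP[w /andP[wX zw]]|noX] := boolP [exists w, (w \in X) && G z w].
  have nYz u : u \in Y -> ~~ G z u by move=> uY; apply: (one z w).
  have [|[Nz _]] := low_triple sXY zL v'L zv' wX yY zw v'y nX nYz vL vz vv'.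
    by left.
  (* The third edge in [type_H3_intro] ends on the side of its second triangle vertex, so [v] and
     [v'], as well as [X] and [Y], are exchanged. *)
  have nin' u : u \in [set v'; v; z] -> (u \notin Y) && (u \notin X).
    by rewrite [[set v'; v]]setUC andbC; exact: nin.
  right; constructor 3; have v'v : v' != v by rewrite eq_sym.
  have dYX : [disjoint Y & X] by rewrite disjoint_sym.
  exact: (type_H3_intro cardV n5 v'v v'z vz cYm cXm nm nin' dYX clY clX nE' yY xX Nv' Nv wX Nz).
have nXz u : u \in X -> ~~ G z u.
  by move=> uX; apply: contra noX => zu; apply/existsP; exists u; rewrite uX.
have [/existsP[w /andP[wY zw]]|noY] := boolP [exists w, (w \in Y) && G z w].
  have [||[_ Nz]] := low_triple sXY vL zL vz xX wY vx zw nXz nY v'L _ v'z.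
  - by rewrite eq_sym.
  - by left.
  right; constructor 3.
  exact: (type_H3_intro cardV n5 vv' vz v'z cXm cYm nm nin dXY clX clY nE xX yY Nv Nv' wY Nz).
right; constructor 2.
apply: (type_H2_intro cardV n5 vv' vz v'z cXm cYm nm nin dXY clX clY nE xX yY Nv Nv').
apply/setP=> u; rewrite inE in_set2; apply/idP/idP=> [zu|].
  have uL : u \in L.
    apply: contraT => uL; have [uX|uX] := boolP (u \in X).
      by rewrite (negPf (nXz _ uX)) in zu.
    case/negP: noY; apply/existsP; exists u; rewrite zu andbT.
    exact: bisected_in uL uX.
  move: uL; rewrite LE !inE => /orP[//|/eqP uz].
  by rewrite uz edge_irrefl in zu.
by case/orP=> /eqP->; apply: low_clique.
Qed.

End Sufficiency.

Theorem theorem1p3 (V : finType) (G : sgraph V) (n : nat) :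
  connected G -> #|V| = n -> 270 <= n ->
  NC_ge G ((n%:R - 1) / 2%:R)%R ->
  (has_HIST G <->
   ~ (exists (W : finType) (H : sgraph W),
        [\/ type_H1 n H, type_H2 n H | type_H3 n H] /\ isomorphic G H) /\
   ~ pendant_adjacent_to_degree_2 G).
Proof.
move=> conG cardV n_ge NCQ.
have NC x y : x != y -> ~~ G x y -> n <= 2 * #|neighbors G x :|: neighbors G y| + 1.
  move=> xy nxy; have := NCQ x y xy nxy.
  rewrite Num.Theory.ler_pdivrMr ?Num.Theory.ltr0n // Num.Theory.lerBlDr.
  by rewrite -GRing.natrM -[1%R]/(1%:R)%R -GRing.natrD Num.Theory.ler_nat mulnC.
split=> [H|[noH noP]].
  split; last by apply: HIST_no_pendant => //; rewrite cardV (leq_trans _ n_ge).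
  case=> W [K [typeK isoK]]; have HK := isomorphic_HIST isoK H.
  case: typeK => [H1|[_ _ [u1 [u2 iso]]]|[_ _ [u1 [u2 [u3 iso]]]]].
  - exact: HIST_no_H1 H1 HK.
  - have [T [TH [conT acT]] dT] := isomorphic_HIST iso HK.
    exact: H2_tree_false conT dT TH.
  - have [T [TH [conT acT]] dT] := isomorphic_HIST iso HK.
    exact: H3_tree_false conT acT dT TH.
(* A separated set other than the whole of [G - L] and its complement there form a bisection; if
   none exists, [G - L] is connected. *)
have [/existsP[X /andP[sX XL]]|noS] :=
    boolP [exists X, separated G n X && (X != ~: low G n)].
  have [//|t] := bisected_dichotomy conG cardV n_ge NC (bisected_complement sX XL).
  by case: noH; exists V, G; split=> //; exact: isomorphic_refl.
apply: (connected_high_HIST conG cardV n_ge NC _ noP) => X sX; apply/eqP; apply: contraNT noS => XL.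
by apply/existsP; exists X; rewrite sX.
Qed.
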